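(* Fix $p \in \mathbb{R}$. Then there exists a constant $C = C(p) > 0$ such that $$- \langle \phi, \partial^4\phi\rangle_p + \|\partial^2\phi\|_p^2 \leq C \|\phi\|_p^2 \quad \text{for all } \phi \in \mathcal{S}.$$ Moreover, the inequality is true for all $\phi \in \mathcal{S}_{p+2}$.
   Context: $\mathcal{S}$ is the (real) Schwartz space of rapidly decreasing smooth functions on $\mathbb{R}$, and $\mathcal{S}'$ is its dual, the space of tempered distributions. Let $\langle\cdot,\cdot\rangle_0$ be the usual inner product on $\mathcal{L}^2(\mathbb{R})$ and let $\{h_k\}_{k=0}^\infty$ be the orthonormal basis of $\mathcal{L}^2(\mathbb{R})$ given by the Hermite functions $h_k(t) = (2^k k!\sqrt{\pi})^{-1/2} e^{-t^2/2} H_k(t)$, where $H_k$ are the (physicists') Hermite polynomials. For $p\in\mathbb{R}$ define on $\mathcal{S}$ the inner product $$\langle f,g\rangle_p := \sum_{k=0}^\infty (2k+1)^{2p}\langle f,h_k\rangle_0\langle g,h_k\rangle_0,$$ with norm $\|\cdot\|_p$. The Hermite-Sobolev space $\mathcal{S}_p$ is the completion of $\mathcal{S}$ in $\|\cdot\|_p$, regarded as a subspace of $\mathcal{S}'$. One has $\mathcal{S}_p\subset\mathcal{S}_q$ for $q<p$. The operator $\partial=\frac{d}{dx}$ acts on $\mathcal{S}$ and is extended to $\mathcal{S}'$ by duality: $\langle\partial\psi,\phi\rangle := -\langle\psi,\partial\phi\rangle$ for $\psi \in \mathcal{S}'$, $\phi\in\mathcal{S}$. It is a bounded linear operator $\mathcal{S}_p\to\mathcal{S}_{p-1/2}$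 for each $p \in \mathbb{R}$, so $\partial^2:\mathcal{S}_p\to\mathcal{S}_{p-1}$ and $\partial^4:\mathcal{S}_p\to\mathcal{S}_{p-2}$ are bounded. *)

(* Defs.v *)
From HB Require Import structures.
From mathcomp Require Import all_boot all_order all_algebra.
From mathcomp Require Import all_classical all_reals all_analysis.

Set Implicit Arguments.
Unset Strict Implicit.
Unset Printing Implicit Defensive.

Import Order.TTheory GRing.Theory Num.Theory.
Import numFieldNormedType.Exports.

Local Open Scope classical_set_scope.
Local Open Scope ring_scope.

Section SchwartzSpace.
Variable R : realType.
Implicit Types f g : R -> R.

Definition smooth f := forall n x, derivable (derive1n n f) x 1.

Definition rapidly_decreasing f :=
  forall m n : nat, exists M : R, forall x, `|x ^+ m * derive1n n f x| <= M.

Definition is_schwartz : {pred R -> R} :=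
  fun f => `[< smooth f /\ rapidly_decreasing f >].

Record schwartz := Schwartz {
  schwartz_fun :> R -> R;
  schwartz_funP : schwartz_fun \in is_schwartz }.

HB.instance Definition _ := [isSub for schwartz_fun].
HB.instance Definition _ := [Choice of schwartz by <:].

Lemma is_schwartzP f :
  reflect (smooth f /\ rapidly_decreasing f) (f \in is_schwartz).
Proof. exact: asboolP. Qed.

Lemma derive1nDZ (a : R) f g n : smooth f -> smooth g ->
  derive1n n (a *: f + g) = a *: derive1n n f + derive1n n g.
Proof.
move=> sf sg; elim: n => [//|n IH]; rewrite !derive1nS IH.
apply/funext => x.
have df := sf n x; have dg := sg n x.
rewrite -[RHS]/(a *: derive1 (derive1n n f) x + derive1 (derive1n n g) x) !derive1E.
by rewrite deriveD ?deriveZ//; exact: derivableZ.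
Qed.

Lemma smoothDZ (a : R) f g : smooth f -> smooth g -> smooth (a *: f + g).
Proof.
move=> sf sg n x; rewrite derive1nDZ//.
by apply: derivableD; [apply: derivableZ; exact: sf|exact: sg].
Qed.

Lemma derive1n_cst0 n : derive1n n (0 : R -> R) = 0.
Proof.
elim: n => [//|n IH]; rewrite derive1nS IH; apply/funext => x.
by rewrite derive1E -[0 in LHS]/(cst 0) derive_cst.
Qed.

Lemma is_schwartz_submod_closed : submod_closed is_schwartz.
Proof.
split.
  apply/is_schwartzP; split=> [n x|m n].
    by rewrite derive1n_cst0; exact: derivable_cst.
  by exists 0 => x; rewrite derive1n_cst0 -[0 x]/(0 : R) mulr0 normr0.
move=> a f g /is_schwartzP[sf bf] /is_schwartzP[sg bg].
apply/is_schwartzP; split; first exact: smoothDZ.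
move=> m n; have [M Mf] := bf m n; have [M' Mg] := bg m n.
exists (`|a| * M + M') => x; rewrite derive1nDZ//.
rewrite -[(_ + _) x]/(a * derive1n n f x + derive1n n g x) mulrDr.
rewrite (le_trans (ler_normD _ _))// lerD// mulrCA normrM.
by rewrite ler_wpM2l.
Qed.

HB.instance Definition _ :=
  GRing.isSubmodClosed.Build R (R -> R) is_schwartz is_schwartz_submod_closed.

HB.instance Definition _ := [SubChoice_isSubLmodule of schwartz by <:].

Lemma derive1_is_schwartz f : f \in is_schwartz -> derive1 f \in is_schwartz.
Proof.
have E n : derive1n n (derive1 f) = derive1n n.+1 f by rewrite /derive1n iterSr.
move=> /is_schwartzP[sf bf]; apply/is_schwartzP; split=> [n x|m n].
  by rewrite E; exact: sf.
by have [M Mf] := bf m n.+1; exists M => x; rewrite E.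
Qed.

Definition sderiv (f : schwartz) : schwartz :=
  Schwartz (derive1_is_schwartz (schwartz_funP f)).

Lemma sderiv_is_linear : linear sderiv.
Proof.
move=> a f g; apply/val_inj => /=.
have /is_schwartzP[sf _] := schwartz_funP f.
have /is_schwartzP[sg _] := schwartz_funP g.
exact: (derive1nDZ a 1 sf sg).
Qed.

HB.instance Definition _ :=
  GRing.isLinear.Build R schwartz schwartz _ sderiv sderiv_is_linear.

Definition seminorm (m n : nat) (f : schwartz) : R :=
  sup (range (fun x => `|x ^+ m * derive1n n f x|)).

(* Continuity for the locally convex topology defined by the family of
   [seminorm]s. *)
Definition schwartz_continuous (T : schwartz -> R) :=
  forall (f : schwartz) (e : R), 0 < e -> exists N : nat, exists2 d : R, 0 < d &
    forall g : schwartz,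
      (forall m n, (m <= N)%N -> (n <= N)%N -> seminorm m n (g - f) < d) ->
      `|T g - T f| < e.

Record tempered := Tempered {
  tempered_fun :> {linear schwartz -> R^o};
  temperedP : schwartz_continuous tempered_fun }.

Section DistributionDerivative.
Variable psi : tempered.

Definition tderiv_fun (f : schwartz) : R^o := - psi (sderiv f).

Lemma tderiv_fun_is_linear : linear tderiv_fun.
Proof. by move=> a f g; rewrite /tderiv_fun linearP linearP opprD scalerN. Qed.

HB.instance Definition _ :=
  GRing.isLinear.Build R schwartz R^o _ tderiv_fun tderiv_fun_is_linear.

Lemma tderiv_fun_continuous : schwartz_continuous tderiv_fun.
Proof.
move=> f e /(temperedP psi (sderiv f))[N [d d0 H]].
exists N.+1, d => // g Hg.
rewrite /tderiv_fun opprK addrC distrC; apply: H => m n mN nN.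
rewrite -linearB; suff -> : seminorm m n (sderiv (g - f)) = seminorm m n.+1 (g - f).
  by apply: Hg => //; exact: leqW.
by rewrite /seminorm /derive1n; under [in RHS]eq_fun do rewrite iterSr.
Qed.

Definition tderiv : tempered := Tempered tderiv_fun_continuous.

End DistributionDerivative.

End SchwartzSpace.

Section HermiteSobolev.
Variable R : realType.
Implicit Types (f g : R -> R) (p : R) (psi chi : tempered R).

Definition inner0 f g : R := \int[@lebesgue_measure R]_x (f x * g x).

(* Rodrigues' formula. *)
Definition hermite (k : nat) (t : R) : R :=
  (-1) ^+ k * expR (t ^+ 2) * derive1n k (fun s : R => expR (- s ^+ 2)) t.

Definition hermite_function (k : nat) (t : R) : R :=
  (Num.sqrt (2 ^+ k * k`!%:R * Num.sqrt pi))^-1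
    * expR (- (t ^+ 2 / 2)) * hermite k t.

Definition inner_p p f g : R :=
  limn [series (2 * k + 1)%:R `^ (2 * p)
    * inner0 f (hermite_function k) * inner0 g (hermite_function k)]_k.

Definition norm_p p f : R := Num.sqrt (inner_p p f f).

Definition norm_cauchy p (u : nat -> schwartz R) :=
  forall e : R, 0 < e -> exists N : nat, forall m n : nat,
    (N <= m)%N -> (N <= n)%N -> norm_p p (u m - u n) < e.

(* [u] represents [psi] as an element of the completion of the Schwartz space
   for [norm_p p]: it is Cauchy and tends to [psi] as tempered distributions, a
   Schwartz function [f] being identified with [inner0 f]. *)
Definition represents p (u : nat -> schwartz R) psi :=
  norm_cauchy p u /\
  forall f : schwartz R, inner0 (u n) f @[n --> \oo] --> psi f.

Definition hermite_sobolev p : set (tempered R) :=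
  [set psi | exists u, represents p u psi].

(* The continuous extension of [inner_p p] to the completion: the common limit
   over all representing sequences (meaningful on [hermite_sobolev p]). *)
Definition hs_inner p psi chi : R :=
  get [set l : R | forall u v, represents p u psi -> represents p v chi ->
         inner_p p (u n) (v n) @[n --> \oo] --> l].

Definition hs_norm p psi : R := Num.sqrt (hs_inner p psi psi).

End HermiteSobolev.

(* Main.v *)
Require Import Defs.
From HB Require Import structures.
From mathcomp Require Import all_boot all_order all_algebra.
From mathcomp Require Import all_classical all_reals all_analysis.
From mathcomp Require Import measurable_realfun ring lra.

(** Write $D$ for the derivative, $E = D^2$, and $W$ for the operator that
multiplies the $k$-th Hermite coefficient by $(2k+1)^{2p}$. Both $W$ and $E$ are
symmetric for the $L^2$ inner product, so that
$$- \langle \phi, D^4 \phi \rangle_p + \|D^2 \phi\|_p^2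
  = \langle (E W E - W E^2) \phi, \phi \rangle_0
  = - \tfrac12 \langle [[W, E], E] \phi, \phi \rangle_0 .$$
In terms of growth in $k$, the operator $W$ has order $2p$ and $E$ has order 1;
each commutator lowers the order of a product by one, so the double commutator has
order $2p$ and is dominated by $W$.

Everything is made explicit on the Hermite coefficients. The ladder relations
$(x \mp d/dx) h_k = \sqrt{2(k+1)}\, h_{k+1}, \sqrt{2k}\, h_{k-1}$, together with
integration by parts, show that the coefficients of a Schwartz function decrease
rapidly ([rapid_coef]) and that $D$ acts on them by a two-term recurrence
([coef_sderiv]). The operator $E$ then links $k$ to $k$ and $k \pm 2$, and the
double commutator appears through a discrete Wronskian: the left-hand side is a
telescoping difference integrated against the weight ([tsum_wronskian]), and a
second summation by parts produces a quadratic form whose coefficients contain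
first and second differences of $k \mapsto (2k+1)^{2p}$
([tsum_wronskian_quadratic]). The mean value theorem bounds these differences
([weight_smooth]), whence [commutator_bound].

For a distribution in the completion, a representing sequence at level $p + 2$
is mapped by $D^j$, for $j \le 4$, to a sequence representing the $j$-th derivative
at level $p$ ([represents_sderiv]). Inner products converge along representing
sequences to the extended inner product ([represents_hs_inner]), so the inequality
for Schwartz functions passes to the limit. *)

Set Implicit Arguments.
Unset Strict Implicit.
Unset Printing Implicit Defensive.

Import Order.TTheory GRing.Theory Num.Theory.
Import numFieldNormedType.Exports.

Local Open Scope classical_set_scope.
Local Open Scope ring_scope.

(** * Rapidly decreasing sequences and their sums *)

Section RapidSequences.
Variable R : realType.
Implicit Types (a b c : nat -> R).

(** The eigenvalues of the harmonic oscillator on the Hermite functions; all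
weights in the Sobolev norms are powers of this sequence. *)
Definition level (k : nat) : R := (2 * k + 1)%:R.

(** The multipliers of the space of [rapid] sequences. *)
Definition slow b := exists n M, forall k, `|b k| <= M * level k ^+ n.

Definition rapid a := forall n, exists M, forall k, level k ^+ n * `|a k| <= M.

Definition tsum a : R := limn (series a).

Lemma level_ge1 k : 1 <= level k.
Proof. by rewrite /level ler1n addn1. Qed.

Lemma level_gt0 k : 0 < level k.
Proof. exact: lt_le_trans ltr01 (level_ge1 k). Qed.

Lemma levelS k : level k.+1 = level k + 2.
Proof. by rewrite /level -natrD; congr _%:R; rewrite mulnS -addnA addnC -addnA. Qed.

Lemma level_le3 k : level k.+1 <= 3 * level k.
Proof. by rewrite levelS; have := level_ge1 k; lra. Qed.

Lemma slow_rapidM b a : slow b -> rapid a -> rapid (fun k => b k * a k).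
Proof.
move=> [n [M bM]] ra m; have [K aK] := ra (m + n)%N.
exists (`|M| * K) => k; rewrite normrM.
have x0 := ltW (level_gt0 k).
apply: (@le_trans _ _ (level k ^+ m * ((`|M| * level k ^+ n) * `|a k|))).
  rewrite ler_wpM2l ?exprn_ge0// ler_wpM2r//.
  by rewrite (le_trans (bM k))// ler_wpM2r ?exprn_ge0// ler_norm.
rewrite [leLHS](_ : _ = `|M| * (level k ^+ (m + n) * `|a k|)); first by rewrite ler_wpM2l.
by rewrite exprD; ring.
Qed.

Lemma rapid_slow a : rapid a -> slow a.
Proof.
move=> /(_ 0)[M aM]; exists 0%N, M => k; rewrite expr0 mulr1.
by have := aM k; rewrite expr0 mul1r.
Qed.

Lemma rapidM a b : rapid a -> rapid b -> rapid (fun k => a k * b k).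
Proof. by move=> /rapid_slow; exact: slow_rapidM. Qed.

Lemma slowM b c : slow b -> slow c -> slow (fun k => b k * c k).
Proof.
move=> [n [M bM]] [m [K cK]]; exists (n + m)%N, (M * K) => k.
by rewrite normrM exprD mulrACA ler_pM.
Qed.

Lemma slowN b : slow b -> slow (fun k => - b k).
Proof. by move=> [n [M bM]]; exists n, M => k; rewrite normrN. Qed.

Lemma slow_cst r : slow (fun=> r).
Proof. by exists 0%N, `|r| => k; rewrite expr0 mulr1. Qed.

Lemma slowD b c : slow b -> slow c -> slow (fun k => b k + c k).
Proof.
move=> [n [M bM]] [m [K cK]]; exists (n + m)%N, (`|M| + `|K|) => k.
have x1 := level_ge1 k; have x0 := ltW (level_gt0 k).
rewrite (le_trans (ler_normD _ _))// mulrDl lerD//.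
  rewrite (le_trans (bM k))// ler_pM ?exprn_ge0 ?ler_norm//; last first.
    by rewrite ler_weXn2l// leq_addr.
  by have := le_trans (normr_ge0 _) (bM k); rewrite pmulr_lge0// exprn_gt0// level_gt0.
rewrite (le_trans (cK k))// ler_pM ?exprn_ge0 ?ler_norm//; last first.
  by rewrite ler_weXn2l// leq_addl.
by have := le_trans (normr_ge0 _) (cK k); rewrite pmulr_lge0// exprn_gt0// level_gt0.
Qed.

Lemma slow_succ b : slow b -> slow (fun k => b k.+1).
Proof.
move=> [n [M bM]]; exists n, (`|M| * 3 ^+ n) => k.
rewrite (le_trans (bM _))// -mulrA -exprMn.
apply: (@le_trans _ _ (`|M| * level k.+1 ^+ n)).
  by rewrite ler_wpM2r ?ler_norm// exprn_ge0// ltW// level_gt0.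
by rewrite ler_wpM2l// lerXn2r ?nnegrE ?level_le3// ?mulr_ge0// ltW// level_gt0.
Qed.

Lemma slow_pred b : slow b -> slow (fun k => b k.-1).
Proof.
move=> [n [M bM]]; exists n, `|M| => -[|k]/=.
  by rewrite (le_trans (bM _))// ler_wpM2r ?ler_norm// exprn_ge0// ltW// level_gt0.
rewrite (le_trans (bM _))// ler_pM ?exprn_ge0 ?ler_norm//.
- by have := le_trans (normr_ge0 _) (bM k); rewrite pmulr_lge0// exprn_gt0// level_gt0.
- by rewrite lerXn2r ?nnegrE ?ltW ?level_gt0// levelS ltrDl.
Qed.

Lemma rapidD a b : rapid a -> rapid b -> rapid (fun k => a k + b k).
Proof.
move=> ra rb n; have [M aM] := ra n; have [K bK] := rb n.
exists (M + K) => k; rewrite (le_trans _ (lerD (aM k) (bK k)))// -mulrDr.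
by rewrite ler_wpM2l ?ler_normD// exprn_ge0// ltW// level_gt0.
Qed.

Lemma rapidN a : rapid a -> rapid (fun k => - a k).
Proof. by move=> ra n; have [M aM] := ra n; exists M => k; rewrite normrN. Qed.

Lemma rapidB a b : rapid a -> rapid b -> rapid (fun k => a k - b k).
Proof. by move=> ra /rapidN; exact: rapidD. Qed.

Lemma rapid_succ a : rapid a -> rapid (fun k => a k.+1).
Proof.
move=> ra n; have [M aM] := ra n; exists M => k; rewrite (le_trans _ (aM k.+1))//.
rewrite ler_wpM2r// lerXn2r ?nnegrE ?ltW ?level_gt0//.
by rewrite levelS ltrDl.
Qed.

Lemma rapid_pred a : rapid a -> rapid (fun k => a k.-1).
Proof.
move=> ra n; have [M aM] := ra n.
exists (3 ^+ n * M) => -[|k]/=.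
  rewrite (le_trans (aM 0%N))// ler_peMl ?exprn_ege1 ?ler1n//.
  by rewrite (le_trans _ (aM 0%N))// mulr_ge0// exprn_ge0// ltW// level_gt0.
apply: (@le_trans _ _ (3 ^+ n * (level k ^+ n * `|a k|))).
  rewrite mulrA -exprMn ler_wpM2r// lerXn2r ?nnegrE ?level_le3//.
  by rewrite mulr_ge0// ltW// level_gt0.
by rewrite ler_wpM2l// exprn_ge0.
Qed.

(** The comparison series for absolute convergence: consecutive reciprocals
telescope. *)
Lemma cvg_series_inv_consecutive : cvgn (series (fun k => (k.+1%:R * k.+2%:R)^-1 : R)).
Proof.
have -> : (fun k => (k.+1%:R * k.+2%:R)^-1 : R) = telescope (fun k => - k.+1%:R^-1).
  apply/funext => k; rewrite /telescope/=.
  have x0 : (0 : R) < k.+1%:R by [].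
  rewrite -(natr1 k.+1); move: x0; move: (k.+1%:R : R) => x x0; field.
  by rewrite !lt0r_neq0// addr_gt0.
rewrite telescopeK; apply: is_cvgB; last exact: is_cvg_cst.
by apply: is_cvgN; apply/cvg_ex; exists 0; exact: cvg_harmonic.
Qed.

Lemma rapid_cvg a : rapid a -> cvgn (series a).
Proof.
move=> /(_ 2)[M aM]; apply: normed_cvg.
apply: (@series_le_cvg _ _ ((2 * `|M|) *: (fun k => (k.+1%:R * k.+2%:R)^-1 : R))) => //=.
- by move=> k; rewrite mulr_ge0.
- move=> k; rewrite -[(_ *: _) k]/((2 * `|M|) * (k.+1%:R * k.+2%:R)^-1).
  rewrite ler_pdivlMr ?mulr_gt0//.
  apply: (@le_trans _ _ (2 * (level k ^+ 2 * `|a k|))); last first.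
    by rewrite ler_wpM2l// (le_trans (aM k))// ler_norm.
  rewrite mulrA mulrC ler_wpM2r// /level natrD natrM -!(natr1 k.+1) -(natr1 k).
  have : (0 : R) <= k%:R by [].
  by move: (k%:R : R) => y y0; nra.
- apply: is_cvg_seriesZ; exact: cvg_series_inv_consecutive.
Qed.

Lemma tsumD a b : rapid a -> rapid b ->
  tsum (fun k => a k + b k) = tsum a + tsum b.
Proof. by move=> /rapid_cvg ca /rapid_cvg cb; rewrite /tsum -lim_seriesD. Qed.

Lemma tsumZ r a : rapid a -> tsum (fun k => r * a k) = r * tsum a.
Proof. by move=> /rapid_cvg ca; exact: (lim_seriesZ r ca). Qed.

Lemma tsumN a : rapid a -> tsum (fun k => - a k) = - tsum a.
Proof. by move=> /rapid_cvg ca; rewrite /tsum -lim_seriesN. Qed.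

Lemma tsumB a b : rapid a -> rapid b ->
  tsum (fun k => a k - b k) = tsum a - tsum b.
Proof. by move=> ra rb; rewrite tsumD ?tsumN//; exact: rapidN. Qed.

Lemma le_tsum a b : rapid a -> rapid b -> (forall k, a k <= b k) ->
  tsum a <= tsum b.
Proof. by move=> /rapid_cvg ca /rapid_cvg cb; exact: lim_series_le. Qed.

Lemma tsumS a : rapid a -> tsum a = a 0%N + tsum (fun k => a k.+1).
Proof.
move=> ra; have c1 := rapid_cvg (rapid_succ ra).
apply/cvg_lim => //; rewrite -cvg_shiftS.
rewrite (_ : (fun n => _) = (fun n => a 0%N + series (fun k => a k.+1) n)).
  by apply: cvgD => //; exact: cvg_cst.
by apply/funext => n; rewrite /series/= big_nat_recl.
Qed.

(** The form of the shift used in summations by parts: the second derivative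
preserves the parity of the index. *)
Lemma tsum2 a : rapid a -> tsum a = a 0%N + a 1%N + tsum (fun k => a k.+2).
Proof. by move=> ra; rewrite tsumS// tsumS ?addrA//; exact: rapid_succ. Qed.

Lemma tsum_ge0 a : rapid a -> (forall k, 0 <= a k) -> 0 <= tsum a.
Proof.
move=> ra a0; rewrite -[leLHS](mul0r (tsum a)) -tsumZ// le_tsum// => [|k].
  by apply: slow_rapidM => //; exact: slow_cst.
by rewrite mul0r.
Qed.

End RapidSequences.

(** * The double commutator in the Hermite basis *)

Section HermiteDerivative.
Variable R : realType.
Implicit Types (a b e : nat -> R).

(** The matrix entries of the derivative in the Hermite basis:
$h_k' = s_k h_{k-1} - s_{k+1} h_{k+1}$ with $s_k = \sqrt{k/2}$. *)
Definition step (k : nat) : R := Num.sqrt (k%:R / 2).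

(** The derivative acting on Hermite coefficients. At [k = 0] the junk value
[a k.-1] is killed by [step 0 = 0]. *)
Definition dseq a (k : nat) : R := step k.+1 * a k.+1 - step k * a k.-1.

Lemma step0 : step 0 = 0.
Proof. by rewrite /step mul0r sqrtr0. Qed.

Lemma step_ge0 k : 0 <= step k.
Proof. exact: sqrtr_ge0. Qed.

Lemma sqr_step k : step k ^+ 2 = k%:R / 2.
Proof. by rewrite /step sqr_sqrtr// divr_ge0. Qed.

Lemma slow_step : slow step.
Proof.
exists 1%N, 1 => k; rewrite expr1 mul1r ger0_norm ?step_ge0//.
rewrite -(ler_pXn2r (ltn0Sn 1)) ?nnegrE ?step_ge0 ?ltW ?level_gt0// sqr_step.
rewrite /level natrD natrM; have : (0 : R) <= k%:R by [].
by move: (k%:R : R) => y; nra.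
Qed.

Lemma rapid_dseq a : rapid a -> rapid (dseq a).
Proof.
move=> ra; apply: rapidB; apply: slow_rapidM.
- exact: slow_succ slow_step.
- exact: rapid_succ.
- exact: slow_step.
- exact: rapid_pred.
Qed.

(** The off-diagonal entries of the second derivative, which links $k$ to
$k \pm 2$ only. *)
Definition jump (k : nat) : R := step k.+1 * step k.+2.

Lemma sqr_jump k : jump k ^+ 2 = (k%:R + 1) * (k%:R + 2) / 4.
Proof.
by rewrite /jump exprMn !sqr_step -!natr1; field.
Qed.

Lemma jump_ge0 k : 0 <= jump k.
Proof. by rewrite mulr_ge0// step_ge0. Qed.

Lemma jump_le k : jump k <= k%:R + 1.
Proof.
rewrite -(ler_pXn2r (ltn0Sn 1)) ?nnegrE ?jump_ge0 ?addr_ge0// sqr_jump.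
have : (0 : R) <= k%:R by [].
by move: (k%:R : R) => y; nra.
Qed.

Lemma slow_jump : slow jump.
Proof. exact: slowM (slow_succ slow_step) (slow_succ (slow_succ slow_step)). Qed.

Lemma dseq2E a (k : nat) : dseq (dseq a) k.+2 =
  jump k.+2 * a k.+4 - (k%:R + 5 / 2) * a k.+2 + jump k * a k.
Proof.
rewrite /dseq/= /jump.
have := sqr_step k.+2; have := sqr_step k.+3.
rewrite -(natr1 k.+2) -(natr1 k.+1) -(natr1 k).
move: (step k.+3) (step k.+2) => x y hx hy.
rewrite (_ : k%:R + 5 / 2 = x ^+ 2 + y ^+ 2); last by rewrite hx hy; field.
by ring.
Qed.

Lemma dseq2E0 a : dseq (dseq a) 0 = jump 0 * a 2 - 1 / 2 * a 0%N.
Proof.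
rewrite /dseq/= /jump step0; have := sqr_step 1.
by move: (step 1) => x hx; rewrite -hx; ring.
Qed.

Lemma dseq2E1 a : dseq (dseq a) 1 = jump 1 * a 3 - 3 / 2 * a 1%N.
Proof.
rewrite /dseq/= /jump step0; have := sqr_step 1; have := sqr_step 2.
move: (step 2) (step 1) => x y hx hy.
by rewrite (_ : 3 / 2 = x ^+ 2 + y ^+ 2); [ring|rewrite hx hy; field].
Qed.

(** The discrete Wronskian of $a$ and $e = D^2 a$ for the symmetric two-step matrix
$D^2$. By the discrete Green identity,
$e_k e_k - a_k (D^2 e)_k$ is the difference of this quantity at $k$ and at
$k - 2$: the diagonal part of $D^2$ cancels. *)
Definition wronskian a (k : nat) : R :=
  jump k * (dseq (dseq a) k * a k.+2 - a k * dseq (dseq a) k.+2).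

Section Weight.
Variables (w : nat -> R) (C : R).
Hypothesis w_ge0 : forall k, 0 <= w k.
Hypothesis w_slow : slow w.
Hypothesis C_ge0 : 0 <= C.
Hypothesis w_ratio : forall k, w k <= C * w k.+2.
Hypothesis w_diff1 : forall k, `|w k - w k.+2| * (k%:R + 1) <= C * w k.
Hypothesis w_diff2 : forall k,
  `|w k - 2 * w k.+2 + w k.+4| * (k%:R + 1) ^+ 2 <= C * w k.

Definition wdiff k := w k - w k.+2.
Local Notation v := wdiff.

(** The quadratic form of the double commutator of the weight with $D^2$, up to
boundary terms at $k = 0, 1$. The coefficients contain only first differences
of the weight times $O(k)$ and second differences times $O(k^2)$, hence they
are of the size of the weight itself. *)
Definition commutator_form a k : R :=
  (v k - v k.+2) * jump k ^+ 2 * a k.+2 ^+ 2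
  + v k.+2 * (jump k ^+ 2 - jump k.+2 ^+ 2) * a k.+2 ^+ 2
  + v k * jump k * (2 * (a k * a k.+2))
  + (v k.+2 - v k) * (jump k * jump k.+2) * (a k * a k.+4).

Lemma slow_wdiff : slow v.
Proof. exact: slowD w_slow (slowN (slow_succ (slow_succ w_slow))). Qed.

Lemma rapid_wronskian a : rapid a -> rapid (wronskian a).
Proof.
move=> ra; have re := rapid_dseq (rapid_dseq ra).
apply: slow_rapidM; first exact: slow_jump.
exact: rapidB (rapidM re (rapid_succ (rapid_succ ra))) (rapidM ra (rapid_succ (rapid_succ re))).
Qed.

(** Summing the Green identity against the weight and shifting one of the two
terms by two moves the difference from the Wronskian onto the weight. *)
Lemma tsum_wronskian a : rapid a ->
  tsum (fun k => w k * (dseq (dseq a) k ^+ 2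
                        - a k * dseq (dseq (dseq (dseq a))) k))
  = tsum (fun k => v k * wronskian a k).
Proof.
move=> ra; have re := rapid_dseq (rapid_dseq ra).
set e := dseq (dseq a) in re *; have ree := rapid_dseq (rapid_dseq re).
have rW := rapid_wronskian ra.
have rwW := slow_rapidM w_slow rW.
(* The Wronskian at k - 2, cut off below 2 where the subtraction is truncated. *)
pose F k := (1 < k)%:R * (w k * wronskian a k.-2).
have rF : rapid F.
  apply: slow_rapidM; last exact: slow_rapidM w_slow (rapid_pred (rapid_pred rW)).
  by exists 0%N, 1 => k; rewrite mulr1; case: leqP; rewrite ?normr1 ?normr0.
transitivity (tsum (fun k => w k * wronskian a k - F k)).
  congr tsum; apply/funext => k; rewrite /F /wronskian -/e expr2.
  case: k => [|[|k]] /=; rewrite {1}/e ?dseq2E0 ?dseq2E1 ?dseq2E.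
  - by ring.
  - by ring.
  - by ring.
rewrite tsumB// (tsum2 rF) {1 2}/F !mul0r !add0r -tsumB//.
  by congr tsum; apply/funext => k; rewrite /F/= mul1r /wdiff mulrBl.
exact: rapid_succ (rapid_succ rF).
Qed.

(** Expanding the Wronskian leaves squares $a_{k+2}^2 - a_k^2$ and products
$a_{k-2} a_{k+2} - a_k a_{k+4}$, whose coefficients exceed the weight by a factor
of order $k$; a further shift by two in both families replaces these
coefficients by their differences. *)
Lemma tsum_wronskian_quadratic a : rapid a ->
  tsum (fun k => v k * wronskian a k) =
  tsum (commutator_form a)
  - v 0 * jump 0 ^+ 2 * a 0%N ^+ 2 - v 1 * jump 1 ^+ 2 * a 1%N ^+ 2.
Proof.
move=> ra.
pose P k := v k * jump k ^+ 2 * a k ^+ 2.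
pose A k := v k * jump k ^+ 2 * a k.+2 ^+ 2 + v k * jump k * 2 * (a k * a k.+2)
  - v k * (jump k * jump k.+2) * (a k * a k.+4).
pose G k := (1 < k)%:R * v k * (jump k * jump k.-2) * (a k.-2 * a k.+2).
have sv := slow_wdiff; have sJ := slow_jump.
have sJ2 := slowM sJ sJ.
have sJJ := slowM sJ (slow_succ (slow_succ sJ)).
have ra2 := rapid_succ (rapid_succ ra); have ra4 := rapid_succ (rapid_succ ra2).
have rP : rapid P by exact: slow_rapidM (slowM sv sJ2) (rapidM ra ra).
have rA : rapid A.
  apply: rapidB; first apply: rapidD.
  - exact: slow_rapidM (slowM sv sJ2) (rapidM ra2 ra2).
  - exact: slow_rapidM (slowM (slowM sv sJ) (slow_cst 2)) (rapidM ra ra2).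
  - exact: slow_rapidM (slowM sv sJJ) (rapidM ra ra4).
have rG : rapid G.
  apply: slow_rapidM; last exact: rapidM (rapid_pred (rapid_pred ra)) ra2.
  apply: slowM; last exact: slowM sJ (slow_pred (slow_pred sJ)).
  apply: slowM sv; exists 0%N, 1 => k; rewrite mulr1.
  by case: leqP; rewrite ?normr1 ?normr0.
transitivity (tsum (fun k => (A k - P k) + G k)).
  congr tsum; apply/funext => k; rewrite /A /P /G /wronskian.
  case: k => [|[|k]] /=; rewrite ?dseq2E0 ?dseq2E1 !dseq2E.
  - by field.
  - by field.
  - by rewrite -(natr1 k.+1) -(natr1 k); field.
rewrite (tsumD (rapidB rA rP) rG) (tsumB rA rP).
rewrite (tsum2 rP) (tsum2 rG) {1 2}/G !mul0r !add0r.
have rP2 := rapid_succ (rapid_succ rP); have rG2 := rapid_succ (rapid_succ rG).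
transitivity (tsum (fun k => (A k - P k.+2) + G k.+2) - P 0%N - P 1%N).
  by rewrite (tsumD (rapidB rA rP2) rG2) (tsumB rA rP2); ring.
rewrite /P; congr (tsum _ - _ - _); apply/funext => k.
by rewrite /commutator_form /A /P /G/= mul1r; ring.
Qed.

(** Each coefficient of the form is a difference [u] of weights times a polynomial
factor [t]; the difference is controlled after multiplication by a majorant
[m] of that factor. *)
Let quad_bound (u t z m c Z : R) :
  `|u| * m <= c -> 0 <= t <= m -> `|z| <= Z -> u * t * z <= c * Z.
Proof.
move=> um /andP[t0 tm] zZ.
rewrite (le_trans (ler_norm _))// !normrM (ger0_norm t0) ler_pM// ?mulr_ge0//.
by rewrite (le_trans _ um)// ler_wpM2l.
Qed.

Let amgm (x y : R) : `|2 * (x * y)| <= x ^+ 2 + y ^+ 2.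
Proof.
have h1 : x ^+ 2 + y ^+ 2 + 2 * (x * y) = (x + y) ^+ 2 by ring.
have h2 : x ^+ 2 + y ^+ 2 - 2 * (x * y) = (x - y) ^+ 2 by ring.
have := sqr_ge0 (x - y); have := sqr_ge0 (x + y); rewrite -h1 -h2 => g1 g2.
by rewrite ler_norml; apply/andP; split; lra.
Qed.

(** The heart of the matter: although each of the two sums on the left involves
four derivatives, their difference is controlled without any loss. *)
Lemma commutator_bound a : rapid a ->
  tsum (fun k => w k * (dseq (dseq a) k ^+ 2
                        - a k * dseq (dseq (dseq (dseq a))) k))
  <= (14 * (C + C ^+ 2 + C ^+ 3)) * tsum (fun k => w k * a k ^+ 2).
Proof.
move=> ra; rewrite tsum_wronskian// tsum_wronskian_quadratic//.
set B := fun k => w k * a k ^+ 2.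
have rB : rapid B by exact: slow_rapidM w_slow (rapidM ra ra).
have rB2 := rapid_succ (rapid_succ rB); have rB4 := rapid_succ (rapid_succ rB2).
have B0 k : 0 <= B k by rewrite mulr_ge0// sqr_ge0.
have tB := tsum2 rB; have tB2 := tsum2 rB2.
have tB2_ge0 := tsum_ge0 rB2 (fun k => B0 k.+2).
have tB4_ge0 := tsum_ge0 rB4 (fun k => B0 k.+4).
(* The powers of C compare the weight at k with those at k + 2 and k + 4. *)
set K := C + C ^+ 2 + C ^+ 3.
have K0 : 0 <= K by rewrite !addr_ge0// exprn_ge0.
have CK : C <= K by rewrite /K -addrA lerDl addr_ge0// exprn_ge0.
have Z_le k : commutator_form a k <= (4 * K) * (B k + B k.+2 + B k.+4).
  have y0 : (0 : R) <= k%:R by [].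
  have r1 := w_ratio k; have r2 := w_ratio k.+2.
  (* Coefficients compared with the weight: second differences of the weight for
  T1 and T4, first differences for T2 and T3. *)
  have T1 : (v k - v k.+2) * jump k ^+ 2 * a k.+2 ^+ 2 <= C * w k * a k.+2 ^+ 2.
    apply: (quad_bound (m := (k%:R + 1) ^+ 2)).
    - by rewrite (_ : v k - v k.+2 = w k - 2 * w k.+2 + w k.+4) ?w_diff2// /wdiff; ring.
    - by rewrite sqr_jump; apply/andP; split; nra.
    - by rewrite ger0_norm ?sqr_ge0.
  have T2 : v k.+2 * (jump k ^+ 2 - jump k.+2 ^+ 2) * a k.+2 ^+ 2
      <= C * w k.+2 * a k.+2 ^+ 2.
    rewrite -mulrNN -mulrN opprB.
    apply: (quad_bound (m := k.+2%:R + 1)).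
    - exact: w_diff1.
    - by rewrite !sqr_jump -(natr1 k.+1) -(natr1 k); apply/andP; split; nra.
    - by rewrite normrN ger0_norm ?sqr_ge0.
  have T3 : v k * jump k * (2 * (a k * a k.+2))
      <= C * w k * (a k ^+ 2 + a k.+2 ^+ 2).
    apply: (quad_bound (m := k%:R + 1)).
    - exact: w_diff1.
    - by rewrite jump_ge0 jump_le.
    - exact: amgm.
  have T4 : (v k.+2 - v k) * (jump k * jump k.+2) * (a k * a k.+4)
      <= 3 * (C * w k) * (a k ^+ 2 + a k.+4 ^+ 2).
    apply: (quad_bound (m := 3 * (k%:R + 1) ^+ 2)).
    - rewrite mulrCA ler_wpM2l// (_ : v k.+2 - v k = - (w k - 2 * w k.+2 + w k.+4)).
        by rewrite normrN w_diff2.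
      by rewrite /wdiff; ring.
    - rewrite mulr_ge0 ?jump_ge0//=.
      rewrite (le_trans (ler_pM _ _ (jump_le k) (jump_le k.+2))) ?jump_ge0//.
      by rewrite -(natr1 k.+1) -(natr1 k); nra.
    - by rewrite (le_trans _ (amgm _ _))// [leRHS]normrM ger0_norm// ler_peMl// ler1n.
  have {}r1 := ler_wpM2l C_ge0 r1.
  have r3 : C * w k <= C * (C * (C * w k.+4)).
    by rewrite (le_trans r1)// !ler_wpM2l.
  have s0 := sqr_ge0 (a k); have s2 := sqr_ge0 (a k.+2); have s4 := sqr_ge0 (a k.+4).
  have {}r1 := ler_wpM2r s2 r1; have {}r3 := ler_wpM2r s4 r3.
  rewrite /commutator_form (le_trans (lerD (lerD (lerD T1 T2) T3) T4))//.
  have := B0 k; have := B0 k.+2; have := B0 k.+4.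
  move: r1 r3; rewrite /B /K.
  have C2 : 0 <= C ^+ 2 by rewrite sqr_ge0.
  have C3 : 0 <= C ^+ 3 by rewrite exprn_ge0.
  have := C_ge0; nra.
(* The boundary terms left by the shifts. *)
have P_le k : (k <= 1)%N -> - (v k * jump k ^+ 2 * a k ^+ 2) <= 2 * K * B k.
  move=> k1; have y1 : k%:R <= (1 : R) by rewrite lern1.
  have y0 : (0 : R) <= k%:R by [].
  rewrite (@le_trans _ _ (C * w k * a k ^+ 2))//.
    rewrite -mulrN; apply: (quad_bound (m := k%:R + 1)).
    - exact: w_diff1.
    - by rewrite sqr_jump; apply/andP; split; nra.
    - by rewrite normrN ger0_norm ?sqr_ge0.
  rewrite -[leLHS]mulrA -/(B k); apply: ler_wpM2r => //.
  by rewrite (le_trans CK)// ler_peMl// ler1n.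
have rZ : rapid (commutator_form a).
  have sv := slow_wdiff; have sJ := slow_jump; have sJ2 := slowM sJ sJ.
  have svS := slow_succ (slow_succ sv); have sJS := slow_succ (slow_succ sJ).
  have ra2 := rapid_succ (rapid_succ ra); have ra4 := rapid_succ (rapid_succ ra2).
  apply: rapidD; first apply: rapidD; first apply: rapidD.
  - apply: slow_rapidM (rapidM ra2 ra2); apply: slowM sJ2.
    exact: slowD sv (slowN svS).
  - apply: slow_rapidM (rapidM ra2 ra2); apply: slowM svS _.
    exact: slowD sJ2 (slowN (slowM sJS sJS)).
  - exact: slow_rapidM (slowM sv sJ) (slow_rapidM (slow_cst 2) (rapidM ra ra2)).
  - apply: slow_rapidM (rapidM ra ra4); apply: slowM (slowM sJ sJS).
    exact: slowD svS (slowN sv).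
rewrite (@le_trans _ _ ((4 * K) * tsum (fun k => B k + B k.+2 + B k.+4)
    + 2 * K * B 0%N + 2 * K * B 1%N))//.
  rewrite lerD ?P_le// lerD ?P_le// -tsumZ; last by do 2?apply: rapidD.
  apply: le_tsum Z_le; last first.
    by apply: slow_rapidM; [exact: slow_cst|do 2?apply: rapidD].
  by [].
rewrite tsumD//; last exact: rapidD.
rewrite tsumD// tB tB2; have := B0 0%N; have := B0 1%N.
have := B0 2%N; have := B0 3%N.
move: tB4_ge0; rewrite /=; move: (B 0%N) (B 1%N) (B 2%N) (B 3%N) (tsum _) => b0 b1 b2 b3 t; nra.
Qed.

End Weight.
End HermiteDerivative.

(** * Differences of the power weights *)

Section PowerWeight.
Variable R : realType.
Implicit Types (p q r s x y : R).

(** Powers of comparable numbers are comparable, whatever the sign of the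
exponent. The factor 9 accommodates a shift from $x$ to $x + 8$ when $x \ge 1$. *)
Lemma powR_le_ratio s x y : 0 < x -> x <= y <= 9 * x ->
  y `^ s <= 9 `^ `|s| * x `^ s /\ x `^ s <= 9 `^ `|s| * y `^ s.
Proof.
move=> x0 /andP[xy yx].
have y0 : 0 < y by exact: lt_le_trans xy.
have t1 : 1 <= y / x by rewrite ler_pdivlMr// mul1r.
have t9 : y / x <= 9 by rewrite ler_pdivrMr.
have t0 : 0 <= y / x by rewrite divr_ge0// ltW.
have -> : y `^ s = (y / x) `^ s * x `^ s by rewrite -powRM ?divfK ?gt_eqF// ltW.
have up u : u <= `|s| -> (y / x) `^ u <= 9 `^ `|s|.
  move=> us; rewrite (le_trans (ler_powR t1 us))//.
  by rewrite ge0_ler_powR// nnegrE.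
split; first by rewrite ler_wpM2r ?powR_ge0// up// ler_norm.
rewrite mulrA -[leLHS]mul1r ler_wpM2r ?powR_ge0//.
have ts : 0 < (y / x) `^ s by rewrite powR_gt0// divr_gt0.
have : (y / x) `^ (- s) <= 9 `^ `|s| by rewrite up// ler_normr lexx orbT.
by rewrite powRN -[X in X <= _]mul1r ler_pdivrMr.
Qed.

Lemma powR_MVT r x h : 0 < x -> 0 < h ->
  exists2 c, x < c < x + h & (x + h) `^ r - x `^ r = r * c `^ (r - 1) * h.
Proof.
move=> x0 h0.
have d z : z \in `[x, x + h]%R -> is_derive z 1 (fun z => z `^ r) (r * z `^ (r - 1)).
  by rewrite in_itv/= => /andP[xz _]; apply: is_derive1_powR; exact: lt_le_trans xz.
have xh : x < x + h by rewrite ltrDl.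
have cont : {within `[x, x + h], continuous (fun z => z `^ r)}.
  by apply: derivable_within_continuous => z /d [].
have [c] := MVT xh (fun z zx => d z (subset_itv_oo_cc zx)) cont.
rewrite in_itv/= => cx ->; exists c => //; congr (_ * _); ring.
Qed.

(** The mean value theorem applied to the increment $(z + h)^r - z^r$, whose
derivative is again an increment. *)
Lemma powR_MVT2 r x h : 0 < x -> 0 < h ->
  exists2 c, x < c < x + h + h &
    x `^ r - 2 * (x + h) `^ r + (x + h + h) `^ r
      = r * (r - 1) * c `^ (r - 1 - 1) * h ^+ 2.
Proof.
move=> x0 h0.
pose f z := (z + h) `^ r - z `^ r.
pose df z := r * (z + h) `^ (r - 1) - r * z `^ (r - 1).
have d z : z \in `[x, x + h]%R -> is_derive z 1 f (df z).
  rewrite in_itv/= => /andP[xz _].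
  have z0 : 0 < z by exact: lt_le_trans xz.
  have zh : 0 < z + h by rewrite addr_gt0.
  have dh : is_derive z 1 (fun z : R => z + h) 1.
    by rewrite -[X in is_derive _ _ _ X]addr0; apply: is_deriveD.
  have := @is_derive1_comp _ (fun z => z `^ r) (fun z => z + h) z _ _
    (is_derive1_powR r zh) dh.
  by rewrite mulr1 => dh1; exact: is_deriveB dh1 (is_derive1_powR r z0).
have xh : x < x + h by rewrite ltrDl.
have cont : {within `[x, x + h], continuous f}.
  by apply: derivable_within_continuous => z /d [].
have [c] := MVT xh (fun z zx => d z (subset_itv_oo_cc zx)) cont.
rewrite in_itv/= => /andP[xc cx] E.
have c0 : 0 < c by exact: lt_trans xc.
have [e /andP[ce ec] E2] := powR_MVT (r - 1) c0 h0.
exists e; first by rewrite (lt_trans xc ce)/= (lt_trans ec)// ltrD2r.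
rewrite (_ : _ - _ + _ = f (x + h) - f x); last by rewrite /f; ring.
rewrite E /df -mulrBr E2; ring.
Qed.

Lemma powR_pred r x : 0 < x -> x `^ r = x `^ (r - 1) * x.
Proof.
move=> x0; rewrite -{3}(powRr1 (ltW x0)) -powRD ?subrK//.
by rewrite (gt_eqF x0) implybT.
Qed.

Definition weight p (k : nat) : R := level R k `^ (2 * p).

Lemma weight_ge0 p k : 0 <= weight p k.
Proof. exact: powR_ge0. Qed.

Lemma slow_weight p : slow (weight p).
Proof.
exists (Num.truncn `|2 * p|).+1, 1 => k; rewrite mul1r ger0_norm ?weight_ge0//.
rewrite -powR_mulrn; last exact/ltW/level_gt0.
rewrite ler_powR ?level_ge1// (le_trans (ler_norm _))// ltW//.
by have /andP[] := truncn_itv (normr_ge0 (2 * p)).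
Qed.

(** Discrete differentiation of $x^{2p}$: a shift by two in $k$ shifts [level] by
4, and each difference gains a factor $1/x$ by the mean value theorem. *)
Lemma weight_smooth p : exists2 C, 0 <= C & [/\
  forall k, weight p k <= C * weight p k.+2,
  forall k, `|weight p k - weight p k.+2| * (k%:R + 1) <= C * weight p k &
  forall k, `|weight p k - 2 * weight p k.+2 + weight p k.+4| * (k%:R + 1) ^+ 2
            <= C * weight p k].
Proof.
rewrite /weight; move: (2 * p) => {p} r.
have n0 s : 0 <= (9 : R) `^ s by exact: powR_ge0.
pose C0 := (9 : R) `^ `|r|.
pose C1 := `|r| * 9 `^ `|r - 1| * 4.
pose C2 := `|r * (r - 1)| * 9 `^ `|r - 1 - 1| * 16.
have C00 : 0 <= C0 by exact: n0.
have C10 : 0 <= C1 by rewrite /C1 !mulr_ge0 ?n0.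
have C20 : 0 <= C2 by rewrite /C2 !mulr_ge0 ?n0.
have lv k : level R k.+2 = level R k + 4 by rewrite !levelS; ring.
have kl k : k%:R + 1 <= level R k.
  by rewrite /level natrD lerD2r ler_nat leq_pmull.
exists (C0 + C1 + C2); first by rewrite !addr_ge0.
split=> k; have x1 := level_ge1 R k; have x0 := level_gt0 R k;
  have k1 := kl k; have k0 : (0 : R) <= k%:R by [].
- have xy : level R k <= level R k.+2 <= 9 * level R k.
    by rewrite lv; apply/andP; split; lra.
  have [_ h] := powR_le_ratio r x0 xy; rewrite (le_trans h)//.
  by rewrite ler_wpM2r ?powR_ge0// -addrA lerDl addr_ge0.
- rewrite distrC lv; have [c /andP[xc cx] ->] := powR_MVT r x0 (ltr0Sn _ 3).
  have xy : level R k <= c <= 9 * level R k by apply/andP; split; lra.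
  have [h _] := powR_le_ratio (r - 1) x0 xy.
  rewrite (@le_trans _ _ (C1 * level R k `^ r))//; last first.
    rewrite ler_wpM2r ?powR_ge0//; lra.
  rewrite !normrM (ger0_norm (powR_ge0 _ _)) (@ger0_norm _ 4)//.
  rewrite (powR_pred r x0) /C1.
  rewrite [leRHS](_ : _ = `|r| * (9 `^ `|r - 1| * level R k `^ (r - 1)) * 4 * level R k);
    last by ring.
  apply: ler_pM k1; rewrite ?addr_ge0 ?mulr_ge0 ?powR_ge0//.
  by rewrite ler_wpM2r// ler_wpM2l.
- have [c /andP[xc cx]] := powR_MVT2 r x0 (ltr0Sn _ 3).
  rewrite !lv => ->.
  have xy : level R k <= c <= 9 * level R k by apply/andP; split; lra.
  have [h _] := powR_le_ratio (r - 1 - 1) x0 xy.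
  rewrite (@le_trans _ _ (C2 * level R k `^ r))//; last first.
    rewrite ler_wpM2r ?powR_ge0//; lra.
  rewrite normrM (@ger0_norm _ (4 ^+ 2))// normrM (ger0_norm (powR_ge0 _ _)).
  rewrite (powR_pred r x0) (powR_pred (r - 1) x0) /C2.
  rewrite [leRHS](_ : _ = `|r * (r - 1)|
    * (9 `^ `|r - 1 - 1| * level R k `^ (r - 1 - 1)) * 4 ^+ 2 * level R k ^+ 2);
    last by ring.
  apply: ler_pM; rewrite ?sqr_ge0 ?mulr_ge0 ?powR_ge0//.
    by rewrite ler_wpM2r// ler_wpM2l.
  by rewrite lerXn2r ?nnegrE ?addr_ge0// ltW.
Qed.

End PowerWeight.

(** * Weighted square-summable sequences *)

Section WeightedNorm.
Variable R : realType.
Implicit Types (p q : R) (a b : nat -> R).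

Lemma weight_half p k : weight (p + 1 / 2) k = weight p k * level R k.
Proof.
rewrite /weight (powR_pred _ (level_gt0 R k)); congr (_ `^ _ * _).
by field.
Qed.

Lemma le_weight p q k : p <= q -> weight p k <= weight q k.
Proof. by move=> pq; rewrite ler_powR ?level_ge1// ler_wpM2l. Qed.

Lemma weight_neighbour p k :
  weight p k <= 9 `^ `|2 * p| * weight p k.+1
  /\ weight p k.+1 <= 9 `^ `|2 * p| * weight p k.
Proof.
have := @powR_le_ratio R (2 * p) (level R k) (level R k.+1) (level_gt0 R k).
rewrite levelS; have := level_ge1 R k => x1.
by case; [apply/andP; split; lra|rewrite /weight levelS].
Qed.

Definition wform p a b := tsum (fun k => weight p k * (a k * b k)).

Lemma rapid_wform p a b : rapid a -> rapid b ->
  rapid (fun k => weight p k * (a k * b k)).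
Proof. by move=> ra rb; exact: slow_rapidM (slow_weight p) (rapidM ra rb). Qed.

Lemma wformC p a b : wform p a b = wform p b a.
Proof. by congr tsum; apply/funext => k; rewrite (mulrC (a k)). Qed.

Lemma wformDl p a b e : rapid a -> rapid b -> rapid e ->
  wform p (fun k => a k + b k) e = wform p a e + wform p b e.
Proof.
move=> ra rb re; rewrite /wform -tsumD; [|exact: rapid_wform|exact: rapid_wform].
by congr tsum; apply/funext => k; ring.
Qed.

Lemma wformZl p r a b : rapid a -> rapid b ->
  wform p (fun k => r * a k) b = r * wform p a b.
Proof.
move=> ra rb; rewrite /wform -tsumZ; last exact: rapid_wform.
by congr tsum; apply/funext => k; ring.
Qed.

Lemma wform_ge0 p a : rapid a -> 0 <= wform p a a.
Proof.
move=> ra; apply: tsum_ge0; first exact: rapid_wform.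
by move=> k; rewrite mulr_ge0 ?weight_ge0// -expr2 sqr_ge0.
Qed.

Lemma le_wform p q a : rapid a -> p <= q -> wform p a a <= wform q a a.
Proof.
move=> ra pq; apply: le_tsum; [exact: rapid_wform|exact: rapid_wform|].
by move=> k; rewrite ler_wpM2r ?le_weight// -expr2 sqr_ge0.
Qed.

(** The discriminant argument; the case of a vanishing form is separate because
the quadratic in [t] is then affine. *)
Lemma wform_cauchy_schwarz p a b : rapid a -> rapid b ->
  wform p a b ^+ 2 <= wform p a a * wform p b b.
Proof.
move=> ra rb; set A := wform p a a; set B := wform p b b; set M := wform p a b.
have quad t : 0 <= A + 2 * t * M + t ^+ 2 * B.
  have rtb : rapid (fun k => t * b k) by exact: slow_rapidM (slow_cst t) rb.
  have rs := rapidD ra rtb.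
  have -> : A + 2 * t * M + t ^+ 2 * B =
      wform p (fun k => a k + t * b k) (fun k => a k + t * b k).
    rewrite wformDl// wformZl// !(wformC p _ (fun k => a k + t * b k)).
    rewrite !wformDl// !wformZl// (wformC p b a) -/A -/B -/M; ring.
  exact: wform_ge0.
have A0 : 0 <= A by exact: wform_ge0.
have : 0 <= B by exact: wform_ge0.
rewrite le_eqVlt => /predU1P[B0|B0].
  rewrite -B0 mulr0; have [->|M0] := eqVneq M 0; first by rewrite expr0n.
  (* The affine function takes the value -1 at this point. *)
  have := quad (- (A + 1) / (2 * M)); rewrite -B0 mulr0 addr0.
  rewrite (_ : 2 * _ * M = - (A + 1)); last by field.
  lra.
have := quad (- M / B); rewrite -(ler_pM2r B0) mul0r.
have -> : (A + 2 * (- M / B) * M + (- M / B) ^+ 2 * B) * B = A * B - M ^+ 2.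
  by field; rewrite gt_eqF.
by rewrite subr_ge0.
Qed.

Lemma wform_triangle p a b : rapid a -> rapid b ->
  Num.sqrt (wform p (fun k => a k + b k) (fun k => a k + b k))
  <= Num.sqrt (wform p a a) + Num.sqrt (wform p b b).
Proof.
move=> ra rb; have rs := rapidD ra rb.
have A0 := wform_ge0 p ra; have B0 := wform_ge0 p rb.
rewrite -(ler_pXn2r (ltn0Sn 1)) ?nnegrE ?addr_ge0 ?sqrtr_ge0//.
rewrite sqr_sqrtr ?wform_ge0// sqrrD !sqr_sqrtr//.
rewrite wformDl// !(wformC p _ (fun k => a k + b k)) !wformDl// (wformC p b a).
have : wform p a b <= Num.sqrt (wform p a a) * Num.sqrt (wform p b b).
  rewrite (le_trans (ler_norm _))// -(ler_pXn2r (ltn0Sn 1)) ?nnegrE ?mulr_ge0 ?sqrtr_ge0//.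
  by rewrite exprMn !sqr_sqrtr// real_normK ?num_real// wform_cauchy_schwarz.
rewrite mulr2n; lra.
Qed.

(** The derivative costs half a unit of regularity: its entries are of order
$\sqrt k$. *)
Lemma dseq_bound p : exists2 C, 0 <= C & forall a, rapid a ->
  wform p (dseq a) (dseq a) <= C * wform (p + 1 / 2) a a.
Proof.
pose C := (9 : R) `^ `|2 * p|; have C0 : 0 <= C by exact: powR_ge0.
exists (3 * C); first by rewrite mulr_ge0.
move=> a ra; pose B k := weight (p + 1 / 2) k * (a k * a k).
have rB : rapid B by exact: rapid_wform.
have B0 k : 0 <= B k by rewrite mulr_ge0 ?weight_ge0// -expr2 sqr_ge0.
have rBS := rapid_succ rB; have rBP := rapid_pred rB.
have rd := rapid_dseq ra.
apply: (@le_trans _ _ (C * tsum (fun k => B k.+1 + B k.-1))).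
  rewrite -tsumZ; last exact: rapidD.
  apply: le_tsum; [exact: rapid_wform| |].
    by apply: slow_rapidM; [exact: slow_cst|exact: rapidD].
  move=> k; rewrite /dseq /B.
  have E x y : (x - y) * (x - y) <= 2 * (x ^+ 2 + y ^+ 2) :> R.
    by have := sqr_ge0 (x + y); nra.
  apply: (@le_trans _ _ (weight p k * (2 * ((step R k.+1 * a k.+1) ^+ 2
     + (step R k * a k.-1) ^+ 2)))).
    by rewrite ler_wpM2l ?weight_ge0.
  rewrite !exprMn !sqr_step !weight_half.
  have a1 := sqr_ge0 (a k.+1); have a2 := sqr_ge0 (a k.-1).
  have [h1 _] := weight_neighbour p k.
  have h2 : weight p k * k%:R <= C * (weight p k.-1 * level R k.-1).
    case: k {h1 a1 a2} => [|k]/=.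
      by rewrite mulr0 !mulr_ge0 ?weight_ge0// ltW// level_gt0.
    have [_ h] := weight_neighbour p k; rewrite mulrA ler_pM ?weight_ge0//.
    by rewrite /level ler_nat addn1 ltnS leq_pmull.
  have h3 : weight p k * k.+1%:R <= C * (weight p k.+1 * level R k.+1).
    rewrite mulrA ler_pM ?weight_ge0//.
    by rewrite /level ler_nat mulnS addn1 ltnS leqW// leqW// leq_pmull.
  have := ler_wpM2r a1 h3; have := ler_wpM2r a2 h2.
  rewrite -!expr2; nra.
rewrite tsumD// (tsumS rBP)/=.
have E : wform (p + 1 / 2) a a = B 0%N + tsum (fun k => B k.+1) by exact: tsumS.
rewrite -[tsum (fun k => B k)]/(wform (p + 1 / 2) a a) E.
have t0 : 0 <= tsum (fun k => B k.+1) by apply: tsum_ge0.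
have := B0 0%N; nra.
Qed.

Lemma commutator_inequality p : exists2 C, 0 < C & forall a, rapid a ->
  - wform p a (dseq (dseq (dseq (dseq a)))) + wform p (dseq (dseq a)) (dseq (dseq a))
  <= C * wform p a a.
Proof.
have [C C0 [h1 h2 h3]] := weight_smooth p.
pose K := 14 * (C + C ^+ 2 + C ^+ 3).
have K0 : 0 <= K by rewrite mulr_ge0// !addr_ge0// exprn_ge0.
exists (K + 1); first by rewrite ltr_wpDl.
move=> a ra; have re := rapid_dseq (rapid_dseq ra).
have rf := rapid_dseq (rapid_dseq re).
have := @commutator_bound _ _ _ (weight_ge0 p) (slow_weight p) C0 h1 h2 h3 _ ra.
set t := tsum _; set s := tsum (fun k => _ * a k ^+ 2) => ts.
have -> : wform p a a = s by [].
have s0 : 0 <= s by exact: wform_ge0.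
rewrite addrC (_ : _ - _ = t); first by rewrite mulrDl mul1r (le_trans ts)// lerDl.
rewrite -tsumB; [|exact: rapid_wform|exact: rapid_wform].
by congr tsum; apply/funext => k; ring.
Qed.

End WeightedNorm.

(** * Integrals of derivatives over the real line *)

Section QuadraticDecay.
Variable R : realType.
Implicit Types f g F : R -> R.
Local Notation mu := (@lebesgue_measure R).
Local Notation oneDsqrV := (fun x : R => (oneDsqr x)^-1).

(** The majorant has an explicit bounded primitive, the arctangent, hence is
integrable. *)
Definition decays f := exists M : R, forall x, `|f x| <= M * (oneDsqr x)^-1.

Lemma oneDsqr_gt0 (x : R) : 0 < oneDsqr x.
Proof. exact: lt_le_trans ltr01 (oneDsqr_ge1 x). Qed.

Lemma integrable_oneDsqrV : mu.-integrable setT (EFin \o oneDsqrV).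
Proof.
have c := @continuous_oneDsqrV R.
apply/integrableP; split.
  by apply/measurable_EFinP; exact: continuous_measurable_fun.
rewrite (_ : (\int[mu]_x _)%E = (\int[mu]_x ((oneDsqr x)^-1)%:E)%E); last first.
  by apply: eq_integral => x _ /=; rewrite ger0_norm// invr_ge0 ltW// oneDsqr_gt0.
rewrite (ge0_symfun_integralT (f := oneDsqrV))//=.
- by rewrite -set_itvcy integral0y_oneDsqr -EFinM ltry.
- by move=> x /=; rewrite /oneDsqr sqrrN.
Qed.

Lemma decays_integrable f : continuous f -> decays f ->
  mu.-integrable setT (EFin \o f).
Proof.
move=> cf [M fM].
apply: (le_integrable measurableT _ _
  (integrableZl measurableT M integrable_oneDsqrV)).
- by apply/measurable_EFinP; exact: continuous_measurable_fun.
- by move=> x _; rewrite lee_fin (le_trans (fM x))// ler_norm.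
Qed.

Lemma decays_cvg0 f : decays f ->
  (f n%:R - f (- n%:R)) @[n --> \oo] --> (0 : R).
Proof.
move=> [M fM].
have b n : `|f n%:R - f (- n%:R)| <= 4 * `|M| * (n.+1%:R)^-1.
  have h : (oneDsqr (n%:R : R))^-1 <= 2 * (n.+1%:R)^-1.
    rewrite -ler_pdivrMl// -invfM lef_pV2 ?posrE ?mulr_gt0 ?oneDsqr_gt0//.
    rewrite /oneDsqr -natr1; have := sqr_ge0 (n%:R - 1 : R).
    by have : (0 : R) <= n%:R by []; nra.
  have hM x : oneDsqr x = oneDsqr n%:R -> `|f x| <= `|M| * (2 * (n.+1%:R)^-1).
    move=> xE; rewrite (le_trans (fM x))// xE.
    rewrite (@le_trans _ _ (`|M| * (oneDsqr (n%:R : R))^-1)) ?ler_wpM2l//.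
    by rewrite ler_wpM2r ?ler_norm// invr_ge0 ltW// oneDsqr_gt0.
  rewrite (le_trans (ler_normB _ _))// (le_trans (lerD (hM _ _) (hM _ _)))//.
    by rewrite /oneDsqr sqrrN.
  by rewrite le_eqVlt; apply/orP; left; apply/eqP; ring.
apply: norm_cvg0.
apply: (@squeeze_cvgr _ _ _ _ (fun=> 0) (fun n => 4 * `|M| * harmonic n)).
- by apply: nearW => n; rewrite normr_ge0 b.
- exact: cvg_cst.
- have c4 : (fun _ : nat => 4 * `|M|) @ \oo --> 4 * `|M| by exact: cvg_cst.
  have := cvgM c4 (@cvg_harmonic R); rewrite mulr0; exact.
Qed.

(** The fundamental theorem of calculus on $[-n, n]$, and dominated convergence
as $n$ grows. *)
Lemma integral_derivative f F : continuous f -> decays f -> decays F ->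
  (forall x : R, is_derive x 1 F (f x)) -> \int[mu]_x f x = 0.
Proof.
move=> cf df dF DF.
have intf := decays_integrable cf df.
pose f_ n := f \_ `[(- n%:R), n%:R].
have [M fM] := df.
have mf : measurable_fun setT f by exact: continuous_measurable_fun.
have intf_ n : (\int[mu]_x (EFin \o f_ n) x = (F n%:R - F (- n%:R))%:E)%E.
  rewrite /f_ -restrict_EFin -integral_mkcond; case: n => [|n].
    by rewrite oppr0 set_itv1 integral_set1 subrr.
  have cF : continuous F by move=> x; apply/differentiable_continuous/derivable1_diffP.
  rewrite EFinB; apply: continuous_FTC2.
  - by rewrite gtrN.
  - exact: continuous_subspaceT.
  - split => [x _ //| |].
      exact/cvg_at_right_filter/cF.
    exact/cvg_at_left_filter/cF.
  - by move=> x _; rewrite derive1E; exact: derive_val.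
have H : (\int[mu]_x (EFin \o f_ n) x)%E @[n --> \oo] --> (\int[mu]_x (EFin \o f) x)%E.
  have [|||||//] := @dominated_convergence _ _ _ mu setT measurableT (fun n => EFin \o f_ n)
    (EFin \o f) (fun x => M%:E * ((oneDsqr x)^-1)%:E)%E.
  - move=> n; apply/measurable_EFinP.
    have [h _] := measurable_restrictT f (measurable_itv `[(- n%:R), (n%:R : R)]).
    exact: h (measurable_funTS mf).
  - by apply/measurable_EFinP; exact: mf.
  - apply: aeW => x _; apply: cvg_near_cst; near=> n.
    rewrite /f_ /= patchE mem_set//= in_itv/= -ler_norml.
    by near: n; exact: nbhs_infty_ger.
  - exact: integrableZl integrable_oneDsqrV.
  - apply: aeW => x n _; rewrite /f_ /patch/=; case: ifP => _; rewrite lee_fin//.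
    by rewrite normr0 (le_trans _ (fM x)).
have : (F n%:R - F (- n%:R))%:E @[n --> \oo] --> (\int[mu]_x f x)%:E.
  rewrite /Rintegral fineK; last exact: integrable_fin_num.
  by under eq_cvg do rewrite -intf_.
by move=> /fine_cvg/(cvg_unique (@Rhausdorff R) (decays_cvg0 dF)) <-.
Unshelve. all: by end_near. Qed.

End QuadraticDecay.

(** * Operations on Schwartz functions *)

Section SchwartzOperations.
Variable R : realType.
Implicit Types (f g : R -> R) (c x : R).

Lemma is_derive1D f g x a b : is_derive x (1 : R) f a -> is_derive x (1 : R) g b ->
  is_derive x (1 : R) (fun y => f y + g y) (a + b).
Proof. by move=> df dg; exact: is_deriveD. Qed.

Lemma is_derive1M f g x a b : is_derive x (1 : R) f a -> is_derive x (1 : R) g b ->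
  is_derive x (1 : R) (fun y => f y * g y) (f x * b + g x * a).
Proof. by move=> df dg; exact: is_deriveM. Qed.

Lemma is_derive1_id x : is_derive x (1 : R) (fun y => y) 1.
Proof. exact: is_derive_id. Qed.

Lemma derive1_is_derive f x a : is_derive x (1 : R) f a -> derive1 f x = a.
Proof. by move=> df; rewrite derive1E; exact: derive_val. Qed.

(** Coinductive principle: instead of computing all derivatives of a function,
exhibit a class stable under differentiation whose members are bounded after
multiplication by powers of the variable. *)
Lemma is_schwartz_class (P : (R -> R) -> Prop) f :
  (forall g, P g -> exists2 dg, P dg & forall x, is_derive x (1 : R) g (dg x)) ->
  (forall g, P g -> forall m : nat, exists M : R, forall x, `|x ^+ m * g x| <= M) ->
  P f -> f \in @is_schwartz R.
Proof.
move=> dP bP Pf.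
have Pn n : P (derive1n n f).
  elim: n => [//|n /dP[dg Pdg dgE]]; rewrite derive1nS.
  by rewrite (_ : derive1 _ = dg)//; apply/funext => x; exact: derive1_is_derive.
apply/is_schwartzP; split=> [n x|m n]; last exact: bP.
by have [dg _ dgE] := dP _ (Pn n); have [] := dgE x.
Qed.

Lemma schwartz_is_derive (u : schwartz R) x : is_derive x (1 : R) u (sderiv u x).
Proof.
have /is_schwartzP[su _] := schwartz_funP u.
by apply: DeriveDef; [exact: (su 0%N x)|rewrite /= derive1E].
Qed.

Lemma continuous_schwartz_fun (u : schwartz R) : continuous u.
Proof.
move=> x; apply/differentiable_continuous/derivable1_diffP.
by have [] := schwartz_is_derive u x.
Qed.

Lemma schwartz_bounded (u : schwartz R) m : exists M : R, forall x, `|x ^+ m * u x| <= M.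
Proof. by have /is_schwartzP[_ bu] := schwartz_funP u; exact: (bu m 0%N). Qed.

Lemma decaysM (u v : schwartz R) : decays (fun x => u x * v x).
Proof.
have [M0 h0] := schwartz_bounded u 0; have [M2 h2] := schwartz_bounded u 2.
have [N hN] := schwartz_bounded v 0.
have {}h0 x : `|u x| <= M0 by have := h0 x; rewrite expr0 mul1r.
have {}hN x : `|v x| <= N by have := hN x; rewrite expr0 mul1r.
exists ((M0 + M2) * N) => x; rewrite ler_pdivlMr ?oneDsqr_gt0// normrM mulrAC.
have o0 := ltW (oneDsqr_gt0 x); rewrite ler_pM// ?mulr_ge0//.
rewrite /oneDsqr mulrDr mulr1 lerD// mulrC.
by rewrite (le_trans _ (h2 x))// normrM (ger0_norm (sqr_ge0 x)).
Qed.

Lemma continuousM_schwartz (u v : schwartz R) : continuous (fun x => u x * v x).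
Proof. by move=> x; apply: cvgM; exact: continuous_schwartz_fun. Qed.

Lemma schwartz_integrable (u v : schwartz R) :
  (@lebesgue_measure R).-integrable setT (EFin \o (fun x => u x * v x)).
Proof. apply: decays_integrable; [exact: continuousM_schwartz|exact: decaysM]. Qed.

(** The stable class consists of the functions $x u(x) + v(x)$ with $u$, $v$
Schwartz. *)
Lemma xmul_is_schwartz (u : schwartz R) : (fun x => x * u x) \in @is_schwartz R.
Proof.
apply: (@is_schwartz_class
  (fun g => exists u v : schwartz R, g = fun x => x * u x + v x)).
- move=> _ [v [w ->]]; exists (fun x => x * sderiv v x + (v x + sderiv w x)).
    exists (sderiv v), (v + sderiv w); exact/funext.
  move=> x; rewrite addrA; apply: is_derive1D; last exact: schwartz_is_derive.
  rewrite -[v x in X in is_derive _ _ _ X]mulr1.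
  exact: is_derive1M (is_derive1_id x) (schwartz_is_derive v x).
- move=> _ [v [w ->]] m; have [M hM] := schwartz_bounded v m.+1.
  have [N hN] := schwartz_bounded w m; exists (M + N) => x.
  rewrite mulrDr mulrA -exprSr (le_trans (ler_normD _ _))// lerD//.
- by exists u, 0; apply/funext => x; rewrite -[X in _ + X]/(0 : R) addr0.
Qed.

Definition xmul (u : schwartz R) : schwartz R := Schwartz (xmul_is_schwartz u).

(** The parameter is arbitrary: $c = 1$ occurs in the Rodrigues formula, $c = 1/2$
in the ground state, and $c = -1/2$ in $e^{t^2/2}$. *)
Definition gaussian c : R -> R := fun x => expR (- (c * x ^+ 2)).

(** The bound comes from one term of the exponential series, of degree larger
than half of [m]. *)
Lemma gaussian_bounded c (m : nat) : 0 < c ->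
  exists M, forall x, `|x ^+ m * gaussian c x| <= M.
Proof.
move=> c0; exists (1 + (m.+1)`!%:R / c ^+ m.+1) => x.
have y0 : 0 <= c * x ^+ 2 by rewrite mulr_ge0 ?sqr_ge0// ltW.
have f0 : 0 < (m.+1)`!%:R :> R by rewrite ltr0n fact_gt0.
have e0 := expR_gt0 (c * x ^+ 2); have e1 := ltW e0; have f1 := ltW f0.
have c1 : 0 <= c ^+ m.+1 by rewrite exprn_ge0 ?ltW.
have y1 : 0 <= (c * x ^+ 2) ^+ m.+1 by rewrite exprn_ge0.
rewrite normrM /gaussian expRN (ger0_norm (_ : 0 <= _^-1)); last by rewrite invr_ge0 ltW.
rewrite ler_pdivrMr// mulrDl mul1r.
have h := expR_ge1Dxn m y0.
have [x1|x1] := leP `|x| 1.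
  rewrite normrX (@le_trans _ _ 1) ?exprn_ile1//.
  rewrite (@le_trans _ _ (expR (c * x ^+ 2)))//.
    by rewrite (le_trans _ h)// lerDl divr_ge0.
  by rewrite lerDl mulr_ge0 ?divr_ge0.
apply: (@le_trans _ _ ((m.+1)`!%:R / c ^+ m.+1 * expR (c * x ^+ 2))); last first.
  by rewrite lerDr ltW.
apply: (@le_trans _ _ ((m.+1)`!%:R / c ^+ m.+1
    * ((c * x ^+ 2) ^+ m.+1 / (m.+1)`!%:R))); last first.
  rewrite ler_wpM2l ?divr_ge0//.
  by rewrite (le_trans _ h)// lerDr.
rewrite [leRHS](_ : _ = (x ^+ 2) ^+ m.+1); last first.
  have : 0 < c ^+ m.+1 by rewrite exprn_gt0.
  rewrite exprMn; move: ((x ^+ 2) ^+ m.+1) (c ^+ m.+1) ((m.+1)`!%:R) f0 => z d F F0 d0.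
  by field; rewrite !gt_eqF.
rewrite normrX -(ger0_norm (sqr_ge0 x)) normrX -exprM.
by rewrite ler_weXn2l ?ltW// mul2n -addnn addSn ltnW// ltnS leq_addr.
Qed.

Lemma is_derive_gaussian c x :
  is_derive x (1 : R) (gaussian c) (- (2 * c * x) * gaussian c x).
Proof.
have dq : is_derive x (1 : R) (fun y => - (c * y ^+ 2)) (- (2 * c * x)).
  have d2 := is_derive1M (is_derive1_id x) (is_derive1_id x).
  have dc := is_derive1M (is_derive_cst c x (1 : R)) d2.
  by apply: (is_derive_eq (is_deriveN dc)); rewrite /cst; ring.
have := is_derive1_comp (g := fun y => - (c * y ^+ 2)) (is_derive_expR _) dq.
by rewrite mulrC.
Qed.

(** The stable class consists of polynomials times the Gaussian. *)
Lemma gaussian_is_schwartz c : 0 < c -> gaussian c \in @is_schwartz R.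
Proof.
move=> c0; apply: (@is_schwartz_class
  (fun g => exists p : {poly R}, g = fun x => p.[x] * gaussian c x)).
- move=> _ [p ->].
  exists (fun x => (p^`() - (2 * c) *: ('X * p)).[x] * gaussian c x).
    by eexists.
  move=> x.
  apply: (is_derive_eq (is_derive1M (is_derive_poly p x) (is_derive_gaussian c x))).
  by rewrite hornerD hornerN hornerZ hornerM hornerX; ring.
- move=> _ [p ->] m.
  have [N hN] := choice (fun i : nat => gaussian_bounded (m + i) c0).
  exists (\sum_(i < size p) `|p`_i| * N i) => x.
  rewrite mulrA horner_coef mulr_sumr mulr_suml.
  rewrite (le_trans (ler_norm_sum _ _ _))// ler_sum// => i _.
  by rewrite mulrCA -exprD -mulrA normrM ler_wpM2l.
- by exists 1; apply/funext => x; rewrite hornerC mul1r.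
Qed.

End SchwartzOperations.

(** * The ladder of Hermite functions *)

Section HermiteFunctions.
Variable R : realType.
Implicit Types (u v w : schwartz R) (k : nat) (x t : R).

Definition hnorm k : R := Num.sqrt (2 ^+ k * k`!%:R * Num.sqrt pi).

(** The factor in $(x - d/dx) h_k = \sqrt{2(k+1)}\, h_{k+1}$. *)
Definition ladder k : R := Num.sqrt (2 * k.+1%:R).

Lemma hnorm_gt0 k : 0 < hnorm k.
Proof. by rewrite sqrtr_gt0 !mulr_gt0 ?exprn_gt0 ?ltr0n ?fact_gt0 ?sqrtr_gt0 ?pi_gt0. Qed.

Lemma ladder_gt0 k : 0 < ladder k.
Proof. by rewrite sqrtr_gt0 mulr_gt0. Qed.

Lemma sqr_ladder k : ladder k ^+ 2 = 2 * k.+1%:R.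
Proof. by rewrite sqr_sqrtr// mulr_ge0. Qed.

Lemma hnormS k : hnorm k.+1 = ladder k * hnorm k.
Proof.
rewrite /hnorm /ladder -sqrtrM ?mulr_ge0// exprS factS natrM; congr Num.sqrt; ring.
Qed.

Let G k : R -> R := derive1n k (gaussian (1 : R)).

Let is_derive_gaussian_deriv k t : is_derive t (1 : R) (G k) (G k.+1 t).
Proof.
have /is_schwartzP[sG _] := gaussian_is_schwartz (ltr01 : (0 : R) < 1).
by apply: DeriveDef; [exact: sG|rewrite /G derive1nS derive1E].
Qed.

(** The exponentials of the Hermite function and of the Rodrigues formula merge,
so that differentiation only shifts the order of the derivative of
$e^{-t^2}$. *)
Lemma hermite_functionE k t : hermite_function k t
  = (hnorm k)^-1 * (-1) ^+ k * (gaussian (- 2^-1) t * G k t).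
Proof.
rewrite /hermite_function /hermite -/(hnorm k) /G.
have -> : gaussian (1 : R) = (fun s => expR (- s ^+ 2)).
  by apply/funext => s; rewrite /gaussian mul1r.
rewrite (_ : gaussian _ t = expR (- (t ^+ 2 / 2)) * expR (t ^+ 2)); first by ring.
by rewrite -expRD /gaussian; congr expR; field.
Qed.

(** The creation relation, read off from the Rodrigues formula. *)
Lemma is_derive_hermite_function k t :
  is_derive t (1 : R) (hermite_function k)
    (t * hermite_function k t - ladder k * hermite_function k.+1 t).
Proof.
rewrite !hermite_functionE hnormS exprS.
rewrite (_ : hermite_function k = fun s =>
  (hnorm k)^-1 * (-1) ^+ k * (gaussian (- 2^-1) s * G k s)); last first.
  by apply/funext => s; rewrite hermite_functionE.
have dc := is_derive_cst ((hnorm k)^-1 * (-1) ^+ k) t (1 : R).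
apply: (is_derive_eq (is_derive1M dc
  (is_derive1M (is_derive_gaussian (- 2^-1) t) (is_derive_gaussian_deriv k t)))).
rewrite /cst; field.
by rewrite !gt_eqF ?hnorm_gt0 ?ladder_gt0.
Qed.

Lemma hermite_function0 : hermite_function 0 = (hnorm 0)^-1 *: gaussian (2^-1 : R).
Proof.
apply/funext => t; rewrite hermite_functionE expr0 mulr1; congr (_ * _).
by rewrite -[G 0 t]/(gaussian 1 t) /gaussian -expRD; congr expR; field.
Qed.

(** By induction, the creation operator being built from multiplication by the
variable and differentiation. *)
Lemma hermite_is_schwartz k : hermite_function k \in @is_schwartz R.
Proof.
elim: k => [|k ih].
  rewrite hermite_function0.
  have c0 : (0 : R) < 2^-1 by rewrite invr_gt0.
  by rewrite rpredZ ?gaussian_is_schwartz.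
pose h := Schwartz ih.
rewrite (_ : hermite_function k.+1 = val ((ladder k)^-1 *: (xmul h - sderiv h))).
  exact: valP.
apply/funext => t.
have dh : sderiv h t = t * hermite_function k t - ladder k * hermite_function k.+1 t.
  exact: (derive1_is_derive (is_derive_hermite_function k t)).
rewrite [RHS](_ : _ = (ladder k)^-1 * (t * hermite_function k t - sderiv h t))//.
by rewrite dh; field; rewrite gt_eqF ?ladder_gt0.
Qed.

Definition hfun k : schwartz R := Schwartz (hermite_is_schwartz k).

Lemma schwartz_ext u v : (forall x, u x = v x) -> u = v.
Proof. by move=> uv; apply/val_inj/funext. Qed.

Lemma schwartzD u v x : (u + v) x = u x + v x. Proof. by []. Qed.

Lemma schwartzN u x : (- u) x = - u x. Proof. by []. Qed.

Lemma schwartzZ a u x : (a *: u) x = a * u x. Proof. by []. Qed.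

(** The creation and annihilation operators, adjoint to each other. *)
Definition raising u := xmul u - sderiv u.
Definition lowering u := xmul u + sderiv u.

Lemma sderiv_xmul u : sderiv (xmul u) = u + xmul (sderiv u).
Proof.
apply: schwartz_ext => x.
rewrite [LHS](derive1_is_derive (is_derive1M (is_derive1_id x) (schwartz_is_derive u x))).
by rewrite mulr1 addrC.
Qed.

Lemma xmul_is_linear : linear (@xmul R).
Proof.
move=> a u v; apply: schwartz_ext => x.
by rewrite -[LHS]/(x * (a * u x + v x)) -[RHS]/(a * (x * u x) + x * v x); ring.
Qed.

HB.instance Definition _ :=
  GRing.isLinear.Build R (schwartz R) (schwartz R) _ (@xmul R) xmul_is_linear.

(** The canonical commutation relation. *)
Lemma lowering_raising u : lowering (raising u) = raising (lowering u) + u *+ 2.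
Proof.
rewrite /lowering /raising !linearB !linearD /= !sderiv_xmul.
by apply: schwartz_ext => x; rewrite mulr2n !(schwartzD, schwartzN); ring.
Qed.

Lemma raising_hfun k : raising (hfun k) = ladder k *: hfun k.+1.
Proof.
apply: schwartz_ext => t.
rewrite -[LHS]/(t * hermite_function k t - derive1 (hermite_function k) t).
rewrite (derive1_is_derive (is_derive_hermite_function k t)).
rewrite -[RHS]/(ladder k * hermite_function k.+1 t); ring.
Qed.


Lemma loweringZ a u : lowering (a *: u) = a *: lowering u.
Proof. by rewrite /lowering !linearZ /= scalerDr. Qed.

Lemma raisingZ a u : raising (a *: u) = a *: raising u.
Proof. by rewrite /raising !linearZ /= scalerDr. Qed.

Lemma lowering_hfun0 : lowering (hfun 0) = 0.
Proof.
apply: schwartz_ext => t.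
have c0 : (0 : R) < 2^-1 by rewrite invr_gt0.
pose h : schwartz R := (hnorm 0)^-1 *: Schwartz (gaussian_is_schwartz c0).
have -> : hfun 0 = h by apply: schwartz_ext => x; rewrite /= hermite_function0.
rewrite /h loweringZ -[RHS](mulr0 (hnorm 0)^-1) schwartzZ; congr (_ * _).
rewrite -[LHS]/(t * gaussian 2^-1 t + derive1 (gaussian 2^-1) t).
rewrite (derive1_is_derive (is_derive_gaussian 2^-1 t)).
by field.
Qed.

(** Algebraic consequence of the commutation relation: the lowering operator
reverts each step of the ladder. *)
Lemma lowering_hfunS k : lowering (hfun k.+1) = ladder k *: hfun k.
Proof.
have l0 j : ladder j != 0 by rewrite gt_eqF ?ladder_gt0.
suff : lowering (raising (hfun k)) = (2 * k.+1%:R) *: hfun k.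
  rewrite raising_hfun loweringZ -sqr_ladder expr2 -scalerA.
  exact: (scalerI (l0 k)).
elim: k => [|k ih]; rewrite lowering_raising.
  by rewrite lowering_hfun0 /raising !linear0 !add0r -scaler_nat mulr1.
have -> : lowering (hfun k.+1) = ladder k *: hfun k.
  move: ih; rewrite raising_hfun loweringZ -sqr_ladder expr2 -scalerA.
  exact: (scalerI (l0 k)).
rewrite raisingZ raising_hfun scalerA -expr2 sqr_ladder -[X in _ + X]scaler_nat -scalerDl.
by congr (_ *: _); rewrite -(natr1 k.+1); ring.
Qed.

Lemma raising_lowering_hfun k : raising (lowering (hfun k)) + hfun k = level R k *: hfun k.
Proof.
case: k => [|k].
  by rewrite lowering_hfun0 /raising !linear0 !add0r /level scale1r.
rewrite lowering_hfunS raisingZ raising_hfun scalerA -expr2 sqr_ladder.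
rewrite -[X in _ + X = _]scale1r -scalerDl; congr (_ *: _).
by rewrite /level natrD natrM.
Qed.

Lemma sderiv_hfun k :
  sderiv (hfun k) = step R k *: hfun k.-1 - step R k.+1 *: hfun k.+1.
Proof.
have E : sderiv (hfun k) = 2^-1 *: (lowering (hfun k) - raising (hfun k)).
  apply: schwartz_ext => x; rewrite schwartzZ /lowering /raising.
  by rewrite !(schwartzD, schwartzN); field.
have L j : 2^-1 * ladder j = step R j.+1.
  apply/eqP; rewrite -(eqrXn2 (ltn0Sn 1)) ?mulr_ge0 ?step_ge0 ?(ltW (ladder_gt0 _))//.
  by rewrite exprMn sqr_ladder sqr_step; apply/eqP; field.
rewrite E raising_hfun scalerBr scalerA L; congr (_ - _).
case: k {E} => [|k]/=; first by rewrite lowering_hfun0 scaler0 step0 scale0r.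
by rewrite lowering_hfunS scalerA L.
Qed.

Lemma inner0C u v : inner0 u v = inner0 v u.
Proof. by congr Rintegral; apply/funext => x; rewrite mulrC. Qed.

Lemma inner0Dl u v w : inner0 (u + v) w = inner0 u w + inner0 v w.
Proof.
rewrite /inner0 -(RintegralD measurableT (schwartz_integrable u w) (schwartz_integrable v w)).
by congr Rintegral; apply/funext => x; rewrite schwartzD mulrDl.
Qed.

Lemma inner0Zl a u v : inner0 (a *: u) v = a * inner0 u v.
Proof.
rewrite /inner0 -(RintegralZl _ measurableT (schwartz_integrable u v)).
by congr Rintegral; apply/funext => x; rewrite schwartzZ mulrA.
Qed.

Lemma inner0Nl u v : inner0 (- u) v = - inner0 u v.
Proof. by rewrite -scaleN1r inner0Zl mulN1r. Qed.

Lemma inner0Bl u v w : inner0 (u - v) w = inner0 u w - inner0 v w.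
Proof. by rewrite inner0Dl inner0Nl. Qed.

Lemma inner0_xmul u v : inner0 (xmul u) v = inner0 u (xmul v).
Proof. by congr Rintegral; apply/funext => x /=; ring. Qed.

(** Integration by parts; no boundary term survives because products of
Schwartz functions vanish at infinity. *)
Lemma inner0_sderiv u v : inner0 (sderiv u) v = - inner0 u (sderiv v).
Proof.
have d x : is_derive x (1 : R) (fun x => u x * v x) (u x * sderiv v x + v x * sderiv u x).
  exact: is_derive1M (schwartz_is_derive u x) (schwartz_is_derive v x).
have := @integral_derivative R (fun x => u x * sderiv v x + v x * sderiv u x)
  (fun x => u x * v x) _ _ (decaysM u v) d.
rewrite (RintegralD measurableT (schwartz_integrable u (sderiv v))
  (schwartz_integrable v (sderiv u))).
rewrite -[X in X + _]/(inner0 u (sderiv v)) -[X in _ + X]/(inner0 v (sderiv u)).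
rewrite (inner0C v) => E; apply/eqP; rewrite -addr_eq0 addrC; apply/eqP/E.
  by move=> x; apply: cvgD; exact: continuousM_schwartz.
have [M hM] := decaysM u (sderiv v); have [N hN] := decaysM v (sderiv u).
by exists (M + N) => x; rewrite mulrDl (le_trans (ler_normD _ _))// lerD.
Qed.

Lemma inner0_ge0 u : 0 <= inner0 u u.
Proof. by apply: Rintegral_ge0 => x _; rewrite -expr2 sqr_ge0. Qed.

Lemma inner0_bound u v : `|inner0 u v| <= (inner0 u u + inner0 v v) / 2.
Proof.
have := inner0_ge0 (u + v); have := inner0_ge0 (u - v).
have E w : inner0 (u + w) (u + w) = inner0 u u + 2 * inner0 u w + inner0 w w.
  rewrite inner0Dl (inner0C u (u + w)) (inner0C w (u + w)) !inner0Dl (inner0C w u).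
  by ring.
rewrite !E (inner0C u (- v)) !inner0Nl (inner0C v (- v)) inner0Nl (inner0C v u).
move=> h1 h2.
by rewrite ler_norml; apply/andP; split; lra.
Qed.

Lemma inner0_raising u v : inner0 (raising u) v = inner0 u (lowering v).
Proof.
rewrite /raising /lowering inner0Bl inner0_xmul inner0_sderiv opprK.
by rewrite !(inner0C u) -inner0Dl.
Qed.

(** Since the two ladder operators are adjoint, going up the ladder preserves the
norm. *)
Lemma inner0_hfun k : inner0 (hfun k) (hfun k) = inner0 (hfun 0) (hfun 0).
Proof.
elim: k => [//|k <-].
have := inner0_raising (hfun k) (hfun k.+1).
rewrite raising_hfun lowering_hfunS inner0Zl (inner0C _ (_ *: _)) inner0Zl.
by move=> /(mulfI _) -> //; rewrite gt_eqF ?ladder_gt0.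
Qed.

Definition coef (u : schwartz R) k : R := inner0 u (hfun k).

Lemma coefD u v k : coef (u + v) k = coef u k + coef v k.
Proof. exact: inner0Dl. Qed.

Lemma coefN u k : coef (- u) k = - coef u k.
Proof. exact: inner0Nl. Qed.

(** The derivative is antisymmetric, and on a Hermite function it is half the
difference of the two ladder operators. *)
Lemma coef_sderiv u : coef (sderiv u) = dseq (coef u).
Proof.
apply/funext => k; rewrite /coef inner0_sderiv sderiv_hfun /dseq.
by rewrite inner0C inner0Bl !inner0Zl opprB !(inner0C u).
Qed.

Definition oscillator u := raising (lowering u) + u.

Lemma coef_oscillator u k : coef (oscillator u) k = level R k * coef u k.
Proof.
rewrite /coef /oscillator inner0Dl inner0_raising (inner0C (lowering u)) -inner0_raising.
by rewrite (inner0C u (hfun k)) -inner0Dl raising_lowering_hfun inner0Zl.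
Qed.

(** Powers of the self-adjoint oscillator $x^2 - d^2/dx^2$ multiply the
$k$-th coefficient by powers of $2k + 1$, while the coefficients of any
Schwartz function are bounded. *)
Lemma rapid_coef u : rapid (coef u).
Proof.
move=> n.
(* The norm of the k-th Hermite function does not depend on k. *)
exists ((inner0 (iter n oscillator u) (iter n oscillator u)
  + inner0 (hfun 0) (hfun 0)) / 2) => k.
rewrite -(inner0_hfun k) (le_trans _ (inner0_bound _ _))//.
rewrite -[inner0 _ (hfun k)]/(coef _ k).
rewrite (_ : coef (iter n oscillator u) k = level R k ^+ n * coef u k).
  by rewrite normrM ger0_norm// exprn_ge0// ltW// level_gt0.
elim: n => [|n ih]; first by rewrite mul1r.
by rewrite iterS coef_oscillator ih exprS mulrA.
Qed.

End HermiteFunctions.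

(** * Hermite-Sobolev norms and the completion *)

Section SobolevNorm.
Variable R : realType.
Implicit Types (p q : R) (f g : schwartz R) (u v : nat -> schwartz R)
  (psi chi : tempered R).

Lemma inner_pE p f g : inner_p p f g = wform p (coef f) (coef g).
Proof.
congr (limn (series _)); apply/funext => k.
by rewrite -[LHS]/(weight p k * coef f k * coef g k) mulrA.
Qed.

Lemma norm_p_ge0 p f : 0 <= norm_p p f.
Proof. exact: sqrtr_ge0. Qed.

Lemma inner_p_ge0 p f : 0 <= inner_p p f f.
Proof. by rewrite inner_pE wform_ge0//; exact: rapid_coef. Qed.

Lemma sqr_norm_p p f : norm_p p f ^+ 2 = inner_p p f f.
Proof. by rewrite sqr_sqrtr// inner_p_ge0. Qed.

Lemma coefDE f g : coef (f + g) = (fun k => coef f k + coef g k).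
Proof. by apply/funext => k; rewrite coefD. Qed.

Lemma norm_pD p f g : norm_p p (f + g) <= norm_p p f + norm_p p g.
Proof.
by rewrite /norm_p !inner_pE coefDE wform_triangle//; exact: rapid_coef.
Qed.

Lemma norm_pN p f : norm_p p (- f) = norm_p p f.
Proof.
rewrite /norm_p !inner_pE; congr (Num.sqrt (tsum _)); apply/funext => k.
by rewrite coefN mulrNN.
Qed.

Lemma norm_pB p f g : `|norm_p p f - norm_p p g| <= norm_p p (f - g).
Proof.
have h1 := norm_pD p (f - g) g; have h2 := norm_pD p (g - f) f.
have E : norm_p p (g - f) = norm_p p (f - g) by rewrite -norm_pN opprB.
rewrite subrK in h1; rewrite subrK E in h2.
by rewrite ler_norml lerBlDr h1 andbT lerNl opprB lerBlDr.
Qed.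

Lemma le_norm_p p q f : p <= q -> norm_p p f <= norm_p q f.
Proof.
by move=> pq; rewrite /norm_p !inner_pE ler_wsqrtr// le_wform//; exact: rapid_coef.
Qed.

Lemma polarization p f g :
  inner_p p f g = (norm_p p (f + g) ^+ 2 - norm_p p (f - g) ^+ 2) / 4.
Proof.
rewrite !sqr_norm_p !inner_pE; set a := coef f; set b := coef g.
have ra : rapid a by exact: rapid_coef.
have rb : rapid b by exact: rapid_coef.
have -> : coef (f + g) = (fun k => a k + b k) by exact: coefDE.
have -> : coef (f - g) = (fun k => a k - b k).
  by apply/funext => k; rewrite coefD coefN.
rewrite /wform -tsumB; last first.
- by apply: rapid_wform; exact: rapidB.
- by apply: rapid_wform; exact: rapidD.
apply: (mulIf (x := 4)) => //; rewrite divfK// mulrC -tsumZ; last exact: rapid_wform.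
by congr tsum; apply/funext => k; ring.
Qed.

Lemma norm_p_sderiv p : exists2 C, 0 < C &
  forall f, norm_p p (sderiv f) <= C * norm_p (p + 1 / 2) f.
Proof.
have [C C0 hC] := dseq_bound p.
exists (Num.sqrt C + 1); first by rewrite ltr_wpDl// sqrtr_ge0.
move=> f; apply: (@le_trans _ _ (Num.sqrt C * norm_p (p + 1 / 2) f)).
  rewrite /norm_p !inner_pE coef_sderiv -sqrtrM// ler_wsqrtr// hC//.
  exact: rapid_coef.
by rewrite ler_wpM2r ?norm_p_ge0// lerDl.
Qed.

Lemma norm_cauchyD p u v : norm_cauchy p u -> norm_cauchy p v ->
  norm_cauchy p (fun n => u n + v n).
Proof.
move=> cu cv e e0; have e2 : 0 < e / 2 by rewrite divr_gt0.
have [N hN] := cu _ e2; have [M hM] := cv _ e2.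
exists (maxn N M) => m n; rewrite !geq_max => /andP[Nm Mm] /andP[Nn Mn].
rewrite opprD addrACA (le_lt_trans (norm_pD _ _ _))//.
by rewrite (splitr e); apply: ltrD; [exact: hN|exact: hM].
Qed.

Lemma norm_cauchyN p u : norm_cauchy p u -> norm_cauchy p (fun n => - u n).
Proof.
move=> cu e /cu[N hN]; exists N => m n Nm Nn.
by rewrite -opprD norm_pN hN.
Qed.

Lemma norm_cauchyB p u v : norm_cauchy p u -> norm_cauchy p v ->
  norm_cauchy p (fun n => u n - v n).
Proof. by move=> cu /norm_cauchyN; exact: norm_cauchyD. Qed.

Lemma norm_cauchy_le p q u : p <= q -> norm_cauchy q u -> norm_cauchy p u.
Proof.
move=> pq cu e /cu[N hN]; exists N => m n Nm Nn.
exact: le_lt_trans (le_norm_p _ pq) (hN _ _ Nm Nn).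
Qed.

Lemma norm_cauchy_sderiv p u : norm_cauchy (p + 1 / 2) u ->
  norm_cauchy p (fun n => sderiv (u n)).
Proof.
move=> cu e e0; have [C C0 hC] := norm_p_sderiv p.
have [N hN] := cu (e / C) (divr_gt0 e0 C0); exists N => m n Nm Nn.
rewrite -linearB (le_lt_trans (hC _))// mulrC -ltr_pdivlMr//.
exact: hN.
Qed.

Lemma norm_cauchy_cvg p u : norm_cauchy p u -> cvgn (fun n => norm_p p (u n)).
Proof.
move=> cu; apply/cauchy_cvgP/cauchy_exP => e /cu[N hN].
exists (norm_p p (u N)); exists N => // n Nn.
rewrite /= /ball/= (le_lt_trans (norm_pB _ _ _))//.
exact: hN.
Qed.

(** Completeness in disguise: the weighted space of sequences has no nonzero Cauchy
limit with vanishing coefficients. For a partial sum the limit in [m] can be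
taken inside, and Fatou's argument bounds the whole norm. *)
Lemma norm_cauchy_cvg0 p u : norm_cauchy p u ->
  (forall k, coef (u n) k @[n --> \oo] --> 0) ->
  norm_p p (u n) @[n --> \oo] --> 0.
Proof.
move=> cu u0; apply/cvgr0Pnorm_le => e e0.
have [N hN] := cu _ e0; exists N => // n /= Nn.
rewrite ger0_norm ?norm_p_ge0//.
rewrite -(ler_pXn2r (ltn0Sn 1)) ?nnegrE ?norm_p_ge0 ?(ltW e0)// sqr_norm_p inner_pE.
pose S f K := \sum_(0 <= k < K) weight p k * (coef f k * coef f k).
have term0 f k : 0 <= weight p k * (coef f k * coef f k).
  by rewrite mulr_ge0 ?weight_ge0// -expr2 sqr_ge0.
have rf f := rapid_cvg (rapid_wform p (rapid_coef f) (rapid_coef f)).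
apply: limr_le; first exact: rf.
apply: nearW => K; rewrite -[series _ K]/(S (u n) K).
have cS : S (u n - u m) K @[m --> \oo] --> S (u n) K.
  rewrite /S; elim: K => [|K ih].
    by rewrite big_geq//; under eq_cvg do rewrite big_geq//; exact: cvg_cst.
  rewrite big_nat_recr//=; under eq_cvg do rewrite big_nat_recr//=.
  apply: cvgD ih _; apply: cvgMl_tmp.
  have c1 : coef (u n - u m) K @[m --> \oo] --> coef (u n) K.
    under eq_cvg do rewrite coefD coefN.
    have cc : (fun _ : nat => coef (u n) K) @ \oo --> coef (u n) K by exact: cvg_cst.
    by have := cvgB cc (u0 K); rewrite subr0; exact.
  exact: (cvgM c1 c1).
rewrite -(cvg_lim _ cS)//; apply: limr_le; first exact: cvgP cS.
exists N => // m /= Nm.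
have : inner_p p (u n - u m) (u n - u m) <= e ^+ 2.
  by rewrite -sqr_norm_p lerXn2r ?nnegrE ?norm_p_ge0// ltW// hN.
apply: le_trans; rewrite inner_pE.
have nd := @nondecreasing_series R _ xpredT 0 (fun k _ _ => term0 (u n - u m) k).
exact: (nondecreasing_cvgn_le nd (rf _) K).
Qed.

Lemma represents_le p q u psi : p <= q -> represents q u psi -> represents p u psi.
Proof. by move=> pq [cu lu]; split=> //; exact: norm_cauchy_le cu. Qed.

(** The derivative of a distribution is represented by the derivatives: half a unit
of regularity pays for the Cauchy property, integration by parts for the weak
limit. *)
Lemma represents_sderiv p u psi : represents (p + 1 / 2) u psi ->
  represents p (fun n => sderiv (u n)) (tderiv psi).
Proof.
move=> [cu lu]; split; first exact: norm_cauchy_sderiv.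
move=> f; rewrite -[tderiv psi f]/(- psi (sderiv f)).
under eq_cvg do rewrite inner0_sderiv.
exact: cvgN (lu _).
Qed.

Lemma represents_coef_cvg p u psi k : represents p u psi ->
  coef (u n) k @[n --> \oo] --> psi (hfun R k).
Proof. by move=> [_]; exact. Qed.

(** The inner product on the completion is well defined: by polarization it suffices
to treat norms; these converge along a Cauchy sequence, and two sequences with
the same distributional limit have the same Hermite coefficients in the limit,
hence the same limit of norms. *)
Lemma represents_hs_inner p u v psi chi : represents p u psi -> represents p v chi ->
  inner_p p (u n) (v n) @[n --> \oo] --> hs_inner p psi chi.
Proof.
move=> ru rv; have [cu _] := ru; have [cv _] := rv.
(* Any sequences give the limit; these two serve to name it. *)
pose l := (limn (fun n => norm_p p (u n + v n)) ^+ 2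
           - limn (fun n => norm_p p (u n - v n)) ^+ 2) / 4.
have main u' v' : represents p u' psi -> represents p v' chi ->
    inner_p p (u' n) (v' n) @[n --> \oo] --> l.
  move=> ru' rv'; have [cu' _] := ru'; have [cv' _] := rv'.
  have same w w' : norm_cauchy p w -> norm_cauchy p w' ->
      (forall k, coef (w' n - w n) k @[n --> \oo] --> 0) ->
      norm_p p (w' n) @[n --> \oo] --> limn (fun n => norm_p p (w n)).
    move=> cw cw' ww'.
    have d0 := norm_cauchy_cvg0 (norm_cauchyB cw' cw) ww'.
    have cl := norm_cauchy_cvg cw.
    have d1 : norm_p p (w' n) - norm_p p (w n) @[n --> \oo] --> 0.
      apply/cvgr0Pnorm_le => e e0; move/cvgr0Pnorm_le : d0 => /(_ e e0).
      apply: filterS => n; rewrite ger0_norm ?norm_p_ge0//.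
      exact/le_trans/norm_pB.
    rewrite -[limn _]add0r.
    rewrite (_ : (fun n => norm_p p (w' n))
      = (fun n => (norm_p p (w' n) - norm_p p (w n)) + norm_p p (w n))).
      exact: (cvgD d1 cl).
    by apply/funext => n; rewrite subrK.
  have c0 (w w' : nat -> schwartz R) xi k : represents p w xi -> represents p w' xi ->
      coef (w' n) k - coef (w n) k @[n --> \oo] --> 0.
    move=> rw rw'; rewrite -(subrr (xi (hfun R k))).
    by apply: cvgB; [exact: represents_coef_cvg rw'|exact: represents_coef_cvg rw].
  under eq_cvg do rewrite polarization.
  apply: cvgMr_tmp; apply: cvgB; rewrite !expr2.
    have h : norm_p p (u' n + v' n) @[n --> \oo] --> limn (fun n => norm_p p (u n + v n)).
      apply: same; [exact: norm_cauchyD|exact: norm_cauchyD|] => k.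
      rewrite -(addr0 0); under eq_cvg do rewrite opprD addrACA coefD !(coefD, coefN).
      by apply: cvgD; [exact: c0 ru ru'|exact: c0 rv rv'].
    exact: (cvgM h h).
  have h : norm_p p (u' n - v' n) @[n --> \oo] --> limn (fun n => norm_p p (u n - v n)).
    apply: same; [exact: norm_cauchyB|exact: norm_cauchyB|] => k.
    rewrite -(subrr 0).
    under eq_cvg do rewrite opprD addrACA coefD -opprD coefN !coefD !coefN.
    by apply: cvgB; [exact: c0 ru ru'|exact: c0 rv rv'].
  exact: (cvgM h h).
have /(_ u v ru rv) := @getI R [set l : R | forall u v, represents p u psi ->
  represents p v chi -> inner_p p (u n) (v n) @[n --> \oo] --> l] l main.
exact.
Qed.

End SobolevNorm.

Unset Implicit Arguments.

Theorem theorem2p2 (R : realType) (p : R) :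
  exists2 C : R, 0 < C &
    (forall phi : schwartz R,
       - inner_p p phi (iter 4 (@sderiv R) phi)
         + norm_p p (iter 2 (@sderiv R) phi) ^+ 2
       <= C * norm_p p phi ^+ 2) /\
    (forall phi : tempered R, hermite_sobolev (p + 2) phi ->
       - hs_inner p phi (iter 4 (@tderiv R) phi)
         + hs_norm p (iter 2 (@tderiv R) phi) ^+ 2
       <= C * hs_norm p phi ^+ 2).
Proof.
have [C C0 hC] := commutator_inequality p.
have ineq (phi : schwartz R) : - inner_p p phi (iter 4 (@sderiv R) phi)
         + norm_p p (iter 2 (@sderiv R) phi) ^+ 2 <= C * norm_p p phi ^+ 2.
  by rewrite !sqr_norm_p !inner_pE /= !coef_sderiv; apply: hC; exact: rapid_coef.
exists C => //; split=> // phi [u ru2].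
have ru : represents p u phi by apply: represents_le ru2; rewrite lerDl.
(* Half a unit of regularity for each derivative: four derivatives use up the
whole surplus in p + 2. *)
have up q n psi (w : nat -> schwartz R) : represents (q + n%:R / 2) w psi ->
    represents q (fun k => iter n (@sderiv R) (w k)) (iter n (@tderiv R) psi).
  elim: n q => [|n ih] q; first by rewrite mul0r addr0.
  move=> rw; apply: represents_sderiv; apply: ih.
  by rewrite (_ : _ + _ = q + n.+1%:R / 2)// -natr1; field.
have ru4 : represents p (fun n => iter 4 (@sderiv R) (u n)) (iter 4 (@tderiv R) phi).
  by apply: up; rewrite (_ : 4 / 2 = 2)//; field.
have ruD2 : represents p (fun n => iter 2 (@sderiv R) (u n)) (iter 2 (@tderiv R) phi).
  by apply: up; apply: represents_le ru2; lra.
have sqr_hs_norm (w : nat -> schwartz R) psi : represents p w psi ->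
    norm_p p (w n) ^+ 2 @[n --> \oo] --> hs_norm p psi ^+ 2.
  move=> rw; have lw := represents_hs_inner rw rw.
  rewrite sqr_sqrtr; first by under eq_cvg do rewrite sqr_norm_p.
  by apply: cvgr_to_ge lw _; apply: nearW => n; exact: inner_p_ge0.
have l1 : - inner_p p (u n) (iter 4 (@sderiv R) (u n))
    + norm_p p (iter 2 (@sderiv R) (u n)) ^+ 2 @[n --> \oo] -->
    - hs_inner p phi (iter 4 (@tderiv R) phi) + hs_norm p (iter 2 (@tderiv R) phi) ^+ 2.
  by apply: cvgD; [exact: cvgN (represents_hs_inner ru ru4)|exact: sqr_hs_norm ruD2].
have l2 : C * norm_p p (u n) ^+ 2 @[n --> \oo] --> C * hs_norm p phi ^+ 2.
  by apply: cvgMl_tmp; exact: sqr_hs_norm ru.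
by apply: (ler_cvg_to l1 l2); apply: nearW => n; exact: ineq.
Qed.
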